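(* Let $\alpha\in P(X)$ be a G-Pfaffian and let $\Delta_\alpha$ be the simplicial complex associated with $I_\alpha(X)$. Then $\Delta_\alpha$ is pure.
   Context: Let $K$ be a field, $X=(X_{ij})$ a skew-symmetric $n\times n$ matrix of indeterminates, and $R=K[X]=K[X_{ij}: 1\le i<j\le n]$. For $1\le a_1<\dots<a_{2t}\le n$, $t\ge1$, $[a_1,\ldots,a_{2t}]$ denotes the Pfaffian of the skew-symmetric submatrix of $X$ with row and column indices $a_1,\ldots,a_{2t}$. $P(X)$ is the set of all Pfaffians of $X$, partially ordered by: $[a_1,\ldots,a_{2t}]\le[b_1,\ldots,b_{2s}]$ iff $t\ge s$ and $a_i\le b_i$ for $i=1,\ldots,2s$. The ideal cogenerated by $\alpha\in P(X)$ is $I_\alpha(X)=(\beta\in P(X): \beta\not\ge\alpha)\subset R$. A term order on $R$ is anti-diagonal if the initial monomial of every Pfaffian $[a_1,\ldots,a_{2t}]$ is $X_{a_1a_{2t}}X_{a_2a_{2t-1}}\cdots X_{a_ta_{t+1}}$. $\alpha$ is called a G-Pfaffian (and $I_\alpha(X)$ a G-Pfaffian ideal) if the natural generators $\{\beta\in P(X):\beta\not\ge\alpha\}$ form a Gröbner basis of $I_\alpha(X)$ with respect to every anti-diagonal term order. Let $X_+=\{(i,j):1\le i<j\le n\}$. The simplicial complex $\Delta_\alpha$ associated with $I_\alpha(X)$ is the family of all subsets $Z\subseteq X_+$ such that $\prod_{(i,j)\in Z}X_{ij}\notin\operatorname{in}(I_\alpha(X))$, the initial ideal being taken with respect to an anti-diagonal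 term order. A simplicial complex is pure if all its facets have the same cardinality. *)

(* Defs.v *)
From HB Require Import structures.
From mathcomp Require Import all_boot all_order all_algebra all_fingroup.
From mathcomp Require Import mpoly.

Set Implicit Arguments.
Unset Strict Implicit.
Unset Printing Implicit Defensive.

Import GRing.Theory.
Local Open Scope ring_scope.

Lemma even_ord_subproof t (i : 'I_t) : (i.*2 < t.*2)%N.
Proof. by rewrite ltn_double. Qed.

Lemma odd_ord_subproof t (i : 'I_t) : (i.*2.+1 < t.*2)%N.
Proof. by rewrite ltn_Sdouble. Qed.

Lemma half_ord_subproof t : (t <= t.*2)%N.
Proof. by rewrite -addnn leq_addr. Qed.

Definition even_ord t (i : 'I_t) : 'I_(t.*2) := Ordinal (even_ord_subproof i).
Definition odd_ord t (i : 'I_t) : 'I_(t.*2) := Ordinal (odd_ord_subproof i).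
Definition half_ord t (i : 'I_t) : 'I_(t.*2) := widen_ord (half_ord_subproof t) i.

(* The permutations s of 'I_(2t) in normal form, s(2i) < s(2i+1) and
   s(0) < s(2) < ..., each represent exactly one perfect matching
   {{s(2i), s(2i+1)}}. *)
Definition matching_perm t (s : 'S_(t.*2)) : bool :=
  [forall i : 'I_t, (s (even_ord i) < s (odd_ord i))%N] &&
  [forall i : 'I_t, forall j : 'I_t,
     (i < j)%N ==> (s (even_ord i) < s (even_ord j))%N].

(* Meaningful for A alternating (skew-symmetric with zero diagonal). Summing
   over matchings avoids the factor 1 / (2^t t!) and so is valid in every
   characteristic. *)
Definition pfaffian (R : comNzRingType) t (A : 'M[R]_(t.*2)) : R :=
  \sum_(s : 'S_(t.*2) | matching_perm s)
     (-1) ^+ s * \prod_(i < t) A (s (even_ord i)) (s (odd_ord i)).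

Section Ideals.
Variable R : comNzRingType.

Definition ideal_gen (S : R -> Prop) (f : R) : Prop :=
  exists s : seq (R * R),
    (forall cg, cg \in s -> S cg.2) /\ f = \sum_(cg <- s) cg.1 * cg.2.

End Ideals.

Section Groebner.
Variables (K : fieldType) (N : nat).
Implicit Types (le : rel 'X_{1..N}) (G I : {mpoly K[N]} -> Prop).

Record term_order le : Prop := TermOrder {
  term_order_anti  : antisymmetric le;
  term_order_trans : transitive le;
  term_order_total : total le;
  term_order_one   : forall m, le 0%MM m;
  term_order_mul   : forall m m1 m2, le m1 m2 -> le (m + m1)%MM (m + m2)%MM
}.

(* A relation rather than a function, as the zero polynomial has no initial
   monomial. *)
Definition initial_monomial le (f : {mpoly K[N]}) (m : 'X_{1..N}) : Prop :=
  m \in msupp f /\ forall m', m' \in msupp f -> le m' m.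

Definition initial_ideal_of le G : {mpoly K[N]} -> Prop :=
  ideal_gen (fun h => exists g m,
    [/\ G g, initial_monomial le g m & h = 'X_[m]]).

(* When I is an ideal, [initial_ideal_of le I] is in(I). *)
Definition groebner_basis le G I : Prop :=
  (forall g, G g -> I g) /\
  (forall h, initial_ideal_of le I h <-> initial_ideal_of le G h).

End Groebner.

Section Complexes.
Variables (T : finType) (Delta : {set T} -> Prop).

Definition facet (F : {set T}) : Prop :=
  Delta F /\ forall G : {set T}, Delta G -> F \subset G -> G = F.

Definition pure : Prop :=
  forall F G : {set T}, facet F -> facet G -> #|F| = #|G|.

End Complexes.

(* The index set X_+. *)
Definition Xplus (n : nat) : finType := {p : 'I_n * 'I_n | (p.1 < p.2)%N}.

Definition nvars (n : nat) : nat := #|Xplus n|.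

(* K[X_ij : i < j] *)
Notation pfring K n := {mpoly K[nvars n]}.

Definition Xvar (K : fieldType) n (p : Xplus n) : pfring K n :=
  'X_(enum_rank p).

(* The monomial X_ij; only meaningful for i < j. *)
Definition Xmon n (i j : 'I_n) : 'X_{1..nvars n} :=
  if insub (i, j) is Some p then U_(enum_rank (p : Xplus n))%MM else 0%MM.

Definition generic_skew_mx (K : fieldType) n : 'M[pfring K n]_n :=
  \matrix_(i, j) if (i < j)%N then 'X_[Xmon i j]
                 else if (j < i)%N then - 'X_[Xmon j i] else 0.

(* Elements of P(X), as index sequences [a_1, ..., a_2t]; indices are counted
   from 0. Distinct sequences give distinct Pfaffians of the generic matrix. *)
Record pfaffian_index (n : nat) := PfaffianIndex {
  pf_half : nat;
  pf_idx : (pf_half.*2).-tuple 'I_n;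
  pf_half_gt0 : (0 < pf_half)%N;
  pf_idx_sorted : sorted (fun i j : 'I_n => (i < j)%N) pf_idx
}.

Section Cogenerated.
Variables (K : fieldType) (n : nat).
Implicit Types a b : pfaffian_index n.

Definition pf_poly a : pfring K n :=
  pfaffian (mxsub (tnth (pf_idx a)) (tnth (pf_idx a)) (generic_skew_mx K n)).

Definition pf_le a b : Prop :=
  (pf_half b <= pf_half a)%N /\
  forall (i : 'I_((pf_half a).*2)) (j : 'I_((pf_half b).*2)),
    i = j :> nat -> (tnth (pf_idx a) i <= tnth (pf_idx b) j)%N.

Definition cogenerators (alpha : pfaffian_index n) (f : pfring K n) : Prop :=
  exists b, ~ pf_le alpha b /\ f = pf_poly b.

Definition cogenerated_ideal (alpha : pfaffian_index n) : pfring K n -> Prop :=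
  ideal_gen (cogenerators alpha).

Definition antidiagonal_monomial a : 'X_{1..nvars n} :=
  (\sum_(i < pf_half a)
     Xmon (tnth (pf_idx a) (half_ord i))
          (tnth (pf_idx a) (rev_ord (half_ord i))))%MM.

Definition antidiagonal (le : rel 'X_{1..nvars n}) : Prop :=
  term_order le /\
  forall a, initial_monomial le (pf_poly a) (antidiagonal_monomial a).

Definition G_pfaffian (alpha : pfaffian_index n) : Prop :=
  forall le, antidiagonal le ->
    groebner_basis le (cogenerators alpha) (cogenerated_ideal alpha).

Definition Delta (le : rel 'X_{1..nvars n}) (alpha : pfaffian_index n)
    (Z : {set Xplus n}) : Prop :=
  ~ initial_ideal_of le (cogenerated_ideal alpha) (\prod_(p in Z) Xvar K p).

End Cogenerated.

(* Main.v *)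
Require Import Defs.
From mathcomp Require Import all_boot all_order all_algebra all_fingroup.
From mathcomp Require Import mpoly zify.

(* Write alpha = [a_0, ..., a_(2t-1)]. The initial monomial of [b_0, ..., b_(2s-1)]
   is a chain of s nested arcs (b_i, b_(2s-1-i)), so for a G-Pfaffian the faces of
   Delta are the sets of arcs all of whose nested chains are >= alpha.

   If a_p > a_(p-1) + 1 for some 2 <= p <= 2t - 2, insert c = a_p - 1 into alpha to
   get a sequence w of odd length. The syzygy sum_j (-1)^j X_(w_0 w_j) Pf(w \ w_j) = 0
   shows that its part with j > p, which lies in I_alpha, has as initial monomial
   some X_(w_0 w_j) in(Pf(w \ w_j)) with 0 < j <= p, and no natural generator has an
   initial monomial dividing this one. Hence a_1, ..., a_(2t-2) are consecutive.

   A face is then described by four conditions (record admissible below), and it is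
   covered by t non-intersecting lattice paths in the grid of arcs, once the rows
   i < a_1 have been merged into one. Counting, for every arc, the paths outside it
   gives a function whose jumps form a larger face; its values on the boundary of
   the grid do not depend on the face, so by telescoping neither does the number of
   jumps. *)

Set Implicit Arguments.
Unset Strict Implicit.
Unset Printing Implicit Defensive.

Import GRing.Theory.

(** * Nested chains and non-intersecting paths *)

Definition nested (x y : nat * nat) : bool := (x.1 < y.1) && (y.2 < x.2).

Lemma nested_trans : transitive nested.
Proof.
by move=> y x z /andP[h1 h2] /andP[h3 h4]; apply/andP; split; lia.
Qed.

Section Height.
Variable W : nat -> nat -> bool.

(** The largest number of pairwise nested arcs of [W] with both ends in [i, j], by recursion on the
    length k = j - i: a chain avoids i, or avoids j, or may have (i, j) as its outermost arc. *)
Fixpoint height_rec (k i : nat) : nat :=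
  if k is k1.+1 then
    maxn (maxn (height_rec k1 i.+1) (height_rec k1 i))
         (W i (i + k) + (if k1 is k2.+1 then height_rec k2 i.+1 else 0))
  else 0.

Definition height i j := height_rec (j - i) i.

Lemma height0 i j : j <= i -> height i j = 0.
Proof. by rewrite /height -subn_eq0 => /eqP ->. Qed.

Lemma heightE i j : i < j -> height i j =
  maxn (maxn (height i.+1 j) (height i j.-1)) (W i j + height i.+1 j.-1).
Proof.
move=> ij; rewrite /height.
have -> : j - i = (j - i.+1).+1 by lia.
have -> : j.-1 - i = j - i.+1 by lia.
rewrite /= (_ : i + (j - i.+1).+1 = j); last by lia.
congr (maxn _ (_ + _)).
case e: (j - i.+1) => [|k]; first by rewrite (_ : j.-1 - i.+1 = 0) //; lia.
by rewrite (_ : j.-1 - i.+1 = k) //; lia.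
Qed.

Lemma height_monol i j : height i.+1 j <= height i j.
Proof.
case: (ltnP i j) => ij; last by rewrite (@height0 i.+1) //; lia.
by rewrite (heightE ij) -maxnA leq_maxl.
Qed.

Lemma height_monor i j : height i j <= height i j.+1.
Proof.
case: (ltnP i j.+1) => ij; last by rewrite (@height0 i j) //; lia.
by rewrite (heightE ij) /= -maxnA maxnCA leq_maxl.
Qed.

(** Only the outermost arc of a nested chain in [i, j] can end at i or at j. *)
Lemma height_shrink i j : height i j <= (height i.+1 j.-1).+1.
Proof.
move e: (j - i) => k; elim/ltn_ind: k i j e => k IHk i j e.
case: (ltnP i j) => ij; last by rewrite height0.
rewrite (heightE ij) !geq_max; apply/andP; split; last by case: (W i j); lia.
apply/andP; split.
  case: (ltnP i.+1 j) => ij'; last by rewrite height0.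
  apply: leq_trans (IHk (j - i.+1) _ _ _ erefl) _; first lia.
  exact: height_monol.
case: (ltnP i j.-1) => ij'; last by rewrite (@height0 i).
apply: leq_trans (IHk (j.-1 - i) _ _ _ erefl) _; first lia.
have -> : j.-1 = j.-1.-1.+1 by lia.
exact: height_monor.
Qed.

Lemma height_arc i j : W i j -> i < j -> height i j = (height i.+1 j.-1).+1.
Proof.
move=> Wij ij; apply/eqP; rewrite eqn_leq height_shrink /=.
by rewrite (heightE ij) Wij leq_max leqnn orbT.
Qed.

End Height.

(* The arcs (i, j) with i <= m are identified with (m, j). *)
Definition collapse (m : nat) (P : nat -> nat -> bool) (i j : nat) : bool :=
  if i == m then [exists i' : 'I_m.+1, P i' j] else P i j.

(** Turns bounds on chains of [P] into bounds on heights after the merging of rows. An arc of the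
    merged row can only be the outermost one of a chain, so it can be replaced by an arc of [P];
    [maxn x.1 m] is the row of an arc after merging. *)
Lemma height_chain (P : nat -> nat -> bool) (m : nat) i j : m <= i ->
  exists c : seq (nat * nat), [/\ sorted nested c,
    {in c, forall x, [/\ P x.1 x.2, i <= maxn x.1 m & x.2 <= j]} &
    size c = height (collapse m P) i j].
Proof.
set W := collapse m P.
move e: (j - i) => k; elim/ltn_ind: k i j e => k IHk i j e mi.
case: (ltnP i j) => ij; last by exists [::]; rewrite height0.
have [c1 [s1 in1 z1]] := IHk (j - i.+1) ltac:(lia) i.+1 j erefl ltac:(lia).
have [c2 [s2 in2 z2]] := IHk (j.-1 - i) ltac:(lia) i j.-1 erefl mi.
have [c3 [s3 in3 z3]] := IHk (j.-1 - i.+1) ltac:(lia) i.+1 j.-1 erefl ltac:(lia).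
rewrite (heightE W ij) -z1 -z2 -z3.
have : exists c : seq (nat * nat), [/\ sorted nested c,
    {in c, forall x, [/\ P x.1 x.2, i <= maxn x.1 m & x.2 <= j]} &
    size c = W i j + size c3].
  case Wij: (W i j); last first.
    by exists c3; split=> // x /in3[Px h1 h2]; split=> //; lia.
  (* The replacement moves the left end outward only, so the arc still encloses [c3]. *)
  have [i' Pi' [im i'i]] : exists2 i', P i' j & (i <= maxn i' m) /\ i' <= i.
    move: Wij; rewrite /W /collapse; case: eqP => [->|_ Pij]; last first.
      by exists i => //; split; lia.
    by case/existsP => i' Pi'; exists i' => //; have := ltn_ord i'; split; lia.
  exists ((i', j) :: c3); split=> //.
    case: c3 s3 in3 {z3} => //= x c3 s3 in3; rewrite s3 andbT /nested /=.
    have [_ h1 h2] := in3 x (mem_head _ _); lia.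
  move=> x; rewrite inE => /predU1P[->|/in3[Px h1 h2]] /=; split=> //; lia.
case=> c4 [s4 in4 z4]; rewrite -z4.
have [le4|lt4] := leqP (maxn (size c1) (size c2)) (size c4).
  by exists c4; split.
have [le2|lt2] := leqP (size c1) (size c2).
  by exists c2; split=> // x /in2[Px h1 h2]; split=> //; lia.
by exists c1; split=> // x /in1[Px h1 h2]; split=> //; lia.
Qed.

(** For alpha = [a_0, ..., a_(2t-1)] the parameters are a0 = a_0, m = a_1 - 1, q = a_(2t-1) and N =
    n - 1. The fields encode alpha <= b for the Pfaffians b built from chains: positions 0 and 1 of
    a single arc, position 1 of a longer chain, the length, and the last position. The middle
    positions follow from position 1, since a_k = m + k there. *)
Record admissible (a0 m q N t : nat) (P : nat -> nat -> bool) : Prop := Admissible {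
  adm_range : forall i j, P i j -> [/\ a0 <= i, i < j, m < j & j <= N];
  adm_inner : forall i1 j1 i2 j2, P i1 j1 -> P i2 j2 ->
    nested (i1, j1) (i2, j2) -> m < i2;
  adm_chain : forall c, sorted nested c -> {in c, forall x, P x.1 x.2} ->
    size c <= t;
  adm_short_chain : forall c, sorted nested c ->
    {in c, forall x, P x.1 x.2 /\ x.2 < q} -> size c < t }.

Section Paths.
Variables (a0 m q N t : nat).
Hypotheses (a0m : a0 <= m) (mq : m < q) (qN : q <= N) (t_gt0 : 0 < t).
Hypothesis t_gt1 : m.+1 < q -> 1 < t.

(** * The paths covering a face and the larger face they form *)

Section Extension.
Variable P : nat -> nat -> bool.
Hypothesis admP : admissible a0 m q N t P.
Local Notation W := (collapse m P).
Local Notation E := (height W).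

Lemma height_le i j : m <= i -> E i j <= t.
Proof.
move=> mi; have [c [s in_c <-]] := height_chain P j mi.
by apply: (adm_chain admP s) => x /in_c[].
Qed.

Lemma height_lt i j : m <= i -> j < q -> E i j < t.
Proof.
move=> mi jq; have [c [s in_c <-]] := height_chain P j mi.
by apply: (adm_short_chain admP s) => x /in_c[Px _ h]; split=> //; lia.
Qed.

Lemma height_mono i j i' j' : i <= i' -> j' <= j -> E i' j' <= E i j.
Proof.
move=> ii jj; rewrite -(subnKC ii) -(subnKC jj).
elim: (i' - i) => [|k IHk]; last first.
  by rewrite addnS; apply: leq_trans (height_monol _ _ _) IHk.
rewrite addn0; elim: (j - j') => [|k IHk]; first by rewrite addn0.
by rewrite addnS; apply: leq_trans IHk (height_monor _ _ _).
Qed.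

(* The number of paths met outside (i, j) on the antidiagonal of (i, j): there are
   [minn (i - m) (N - j)] cells, and the [E i j] innermost of the t paths are needed
   to cover the arcs of P inside (i, j). On an antidiagonal that starts left of q
   the first path is counted as met before the first cell, which excludes nested
   chains of t arcs left of q. *)
Definition outer i j :=
  minn (minn (i - m) (N - j) + (j + (i - m) < q)) (t - E i j).

(** The cells of the t paths: the step from (i, j) to (i + 1, j - 1) stays on an antidiagonal, and
    [outer] grows there exactly when (i, j) lies on a path. *)
Definition jump i j : bool := outer i.+1 j.-1 == (outer i j).+1.

(** The step inward keeps i + j, hence the indicator in [outer]; both i - m and N - j grow by one,
    and t - E grows by at most one by [height_shrink]. *)
Lemma outer_step i j : m <= i -> i < j -> j <= N ->
  outer i j <= outer i.+1 j.-1 <= (outer i j).+1.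
Proof.
move=> mi ij jN; rewrite /outer.
have -> : (j.-1 + (i.+1 - m) < q) = (j + (i - m) < q) by congr (_ < _); lia.
have h1 := height_shrink W i j.
have h2 : E i.+1 j.-1 <= E i j by apply: height_mono; lia.
case: (_ < q); lia.
Qed.

Lemma jump_nat i j : m <= i -> i < j -> j <= N ->
  outer i.+1 j.-1 = outer i j + jump i j.
Proof.
by move=> mi ij jN; have := outer_step mi ij jN; rewrite /jump; case: eqP; lia.
Qed.

(** At an arc the height drops by exactly one, so both arguments of the outer minimum grow by one;
    [height_le] ensures that t - E is not truncated. *)
Lemma jump_arc i j : m <= i -> i < j -> j <= N -> W i j -> jump i j.
Proof.
move=> mi ij jN Wij; rewrite /jump /outer.
have -> : (j.-1 + (i.+1 - m) < q) = (j + (i - m) < q) by congr (_ < _); lia.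
have h1 := height_arc Wij ij; have h2 := height_le j mi.
apply/eqP; case: (_ < q); lia.
Qed.

Lemma outer_mono i j i' j' : m <= i -> i <= i' -> j' <= j -> j <= N ->
  outer i j <= outer i' j'.
Proof.
move=> mi ii jj jN; have := height_mono ii jj; rewrite /outer.
(* If the indicator is lost on the way, then i < i', and i - m < N - j because q <= N; the number of
   cells then makes up for the loss. *)
case: (ltnP (j + _) q); case: (ltnP (j' + _) q); lia.
Qed.

Lemma outer_le i j : outer i j <= t.
Proof. by rewrite /outer; lia. Qed.

(** With the next two lemmas this gives [outer] on the boundary of the grid, by values that do not
    mention [P]. *)
Lemma outer_left j : outer m j = (j < q).
Proof.
rewrite /outer subnn addn0 min0n add0n.
case: ltnP => jq; last by rewrite min0n.
by have := height_lt (leqnn m) jq; lia.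
Qed.

Lemma outer_right i : outer i N = 0.
Proof. by rewrite /outer subnn minn0 add0n; case: ltnP; lia. Qed.

Lemma outer_diag i j : j <= i ->
  outer i j = minn (minn (i - m) (N - j) + (j + (i - m) < q)) t.
Proof. by move=> ji; rewrite /outer height0 // subn0. Qed.

Lemma outer_gt0 i j : m <= i -> j < q -> 0 < outer i j.
Proof.
move=> mi jq; have := height_lt mi jq.
case: (ltnP m i) => mi'; last by rewrite (_ : i = m) ?outer_left ?jq //; lia.
rewrite /outer; case: (_ < q); lia.
Qed.

(** * The staircase formed by the arcs in the merged rows *)

Definition first_row_test j i : bool :=
  (i == m) || (a0 <= i) && [exists j' : 'I_N.+1, (j <= j') && P i j'].

Lemma first_row_ex j : exists i, first_row_test j i.
Proof. by exists m; rewrite /first_row_test eqxx. Qed.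

(** By [adm_inner] the rows i <= m of the arcs of [P] increase weakly with the column, so these arcs
    lie on a staircase, and [first_row j] is the row where it enters column j. The values a0 for j
    <= m + 1 and m when no arc remains fix its two ends. *)
Definition first_row j : nat :=
  if j <= m.+1 then a0 else ex_minn (first_row_ex j).

Lemma first_row_range j : a0 <= first_row j <= m.
Proof.
rewrite /first_row; case: ifP => _; first by rewrite leqnn.
case: ex_minnP => i Qi mini; rewrite mini /first_row_test ?eqxx // andbT.
by case/orP: Qi => [/eqP -> //|/andP[]].
Qed.

Lemma first_row_le j j' i : i <= m -> j <= j' -> P i j' -> first_row j <= i.
Proof.
move=> im jj Pij; have [ai ij mj jN] := adm_range admP Pij.
rewrite /first_row; case: ifP => // _.
case: ex_minnP => i' _; apply; rewrite /first_row_test ai /=.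
apply/orP; right; apply/existsP; exists (Ordinal (jN : j' < N.+1)).
by rewrite jj.
Qed.

Lemma first_row_witness j : m.+1 < j ->
  first_row j = m \/ exists2 j', j <= j' & P (first_row j) j'.
Proof.
move=> mj; rewrite /first_row (leqNgt j) mj /=.
case: ex_minnP => i /orP[/eqP -> _|/andP[_ /existsP[j' /andP[jj Pij]]] _].
  by left.
by right; exists j'.
Qed.

Lemma first_row_mono j : first_row j <= first_row j.+1.
Proof.
have /andP[h1 h2] := first_row_range j.
have /andP[h3 h4] := first_row_range j.+1.
case: (ltnP m.+1 j.+1) => mj; last by rewrite {1}/first_row (ltnW mj).
have [-> //|[j' jj Pj']] := first_row_witness mj.
by apply: first_row_le Pj' => //; lia.
Qed.

Lemma first_row_ge j i : i <= m -> P i j -> i <= first_row j.+1.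
Proof.
move=> im Pij; have [ai ij mj jN] := adm_range admP Pij.
have [-> //|[j' jj Pj']] := @first_row_witness j.+1 mj.
rewrite leqNgt; apply/negP => lt.
have := adm_inner admP Pj' Pij; rewrite /nested /= lt jj => /(_ isT); lia.
Qed.

Lemma first_row_const j : m.+1 < j -> (forall i, i <= m -> ~~ P i j) ->
  first_row j.+1 = first_row j.
Proof.
move=> mj noP; apply/eqP; rewrite eqn_leq first_row_mono andbT.
have /andP[h1 h2] := first_row_range j.
have /andP[h3 h4] := first_row_range j.+1.
have [-> //|[j' jj Pj']] := first_row_witness mj.
apply: (@first_row_le _ j') => //.
by case: (ltngtP j j') jj => // e _; have := noP _ h2; rewrite [X in P _ X]e Pj'.
Qed.

Lemma first_row_start : first_row m.+1 = a0.
Proof. by rewrite /first_row leqnn. Qed.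

Lemma first_row_end : first_row N.+1 = m.
Proof.
have [//|[j' jj Pj']] := @first_row_witness N.+1 ltac:(lia).
by have [_ _ _] := adm_range admP Pj'; lia.
Qed.

(** A jump of the merged row in column j is spread over the whole vertical step of the staircase in
    that column. *)
Definition extension i j : bool :=
  [&& a0 <= i, i < j, m < j, j <= N &
      if m < i then jump i j else jump m j && (first_row j <= i <= first_row j.+1)].

Lemma extension_sub i j : P i j -> extension i j.
Proof.
move=> Pij; have [ai ij mj jN] := adm_range admP Pij.
rewrite /extension ai ij mj jN /=; case: ltnP => mi.
  by apply: jump_arc => //; [lia|rewrite /collapse (gtn_eqF mi)].
rewrite (@first_row_le j j) // first_row_ge // !andbT.
apply: jump_arc => //; rewrite /collapse eqxx; apply/existsP.
by exists (Ordinal (mi : i < m.+1)).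
Qed.

Lemma extension_jump i j : extension i j -> jump (maxn i m) j.
Proof.
case/and5P => _ _ _ _; by case: ltnP => // _ /andP[].
Qed.

(** If both arcs were in the merged rows, the staircase would give i2 <= first_row (j2 + 1) <=
    first_row j1 <= i1. *)
Lemma extension_inner i1 j1 i2 j2 : extension i1 j1 -> extension i2 j2 ->
  i1 < i2 -> j2 < j1 -> m < i2.
Proof.
move=> /and5P[_ _ _ _ e1] /and5P[_ _ _ _ e2] ii jj; rewrite ltnNge; apply/negP => i2m.
move: e1 e2; rewrite (ltnNge m i2) i2m /= ltnNge (leq_trans (ltnW ii) i2m) /=.
move=> /and3P[_ h1 _] /and3P[_ _ h2].
have h3 : first_row j2.+1 <= first_row j1.
  rewrite -(subnKC jj); elim: (j1 - j2.+1) => [|k IHk]; first by rewrite addn0.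
  by rewrite addnS; apply: leq_trans IHk (first_row_mono _).
lia.
Qed.

Section Chains.
Variables (s : nat) (u v : nat -> nat).
Hypothesis s_gt0 : 0 < s.
Hypothesis u_mono : forall k, k.+1 < s -> u k < u k.+1.
Hypothesis v_mono : forall k, k.+1 < s -> v k.+1 < v k.
Hypothesis ext_uv : forall k, k < s -> extension (u k) (v k).

(** Each arc of the chain is a jump, which raises [outer] by one, and [outer] does not decrease from
    there to the next arc. By [extension_inner] the next arc starts to the right of m, so it lies
    inside the cell reached by the jump. *)
Lemma extension_chain_outer k : k < s ->
  outer (maxn (u 0) m) (v 0) + k <= outer (maxn (u k) m) (v k).
Proof.
elim: k => [|k IHk] ks; first by rewrite addn0.
rewrite addnS; apply: leq_ltn_trans (IHk (ltnW ks)) _.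
have ek := ext_uv (ltnW ks); have ek' := ext_uv ks.
have mu := extension_inner ek ek' (u_mono ks) (v_mono ks).
have /eqP <- := extension_jump ek.
have vk := v_mono ks; have uk := u_mono ks.
case/and5P: ek => _ _ _ vN _.
apply: outer_mono; lia.
Qed.

Lemma extension_chain : outer (maxn (u 0) m) (v 0) + s <= t.
Proof.
have ks : s.-1 < s by lia.
have h := extension_chain_outer ks.
have /eqP j := extension_jump (ext_uv ks).
have := outer_le (maxn (u s.-1) m).+1 (v s.-1).-1; lia.
Qed.

Lemma extension_chain_size : s <= t.
Proof. by have := extension_chain; lia. Qed.

Lemma extension_short_chain : v 0 < q -> s < t.
Proof.
move=> vq; have := extension_chain.
by have := @outer_gt0 (maxn (u 0) m) (v 0) ltac:(lia) vq; lia.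
Qed.

End Chains.

(** * Counting the arcs of the extension *)

Lemma sum_interval l h : l <= h -> h <= m ->
  \sum_(0 <= i < m.+1) (l <= i <= h) = (h - l).+1.
Proof.
move=> lh hm; rewrite (@big_cat_nat _ _ _ l) /=; [|lia|lia].
rewrite big_nat_cond big1 ?add0n; last by move=> i /andP[/andP[_ il] _]; lia.
rewrite (@big_cat_nat _ _ _ h.+1) /=; [|lia|lia].
rewrite [X in _ + X]big_nat_cond [X in _ + X]big1 ?addn0; last first.
  by move=> i /andP[/andP[il _] _]; lia.
rewrite big_nat_cond (eq_bigr (fun=> 1)); last by move=> i; lia.
by rewrite -big_nat_cond sum_nat_const_nat; lia.
Qed.

(** Column j stands for the arcs (i, j + 1) and the factor [i <= j] selects the cells above the
    diagonal; the rectangular range serves the telescoping in both directions. *)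
Definition num_jumps := \sum_(m <= i < N) \sum_(0 <= j < N) (i <= j) * jump i j.+1.

(** Column m + 1 is outside the reach of [first_row_const], since [first_row] has a conventional
    value there. That column is always a jump, so the rise of the staircase in it is counted. *)
Lemma jump_first : jump m m.+1.
Proof.
rewrite /jump outer_left /= outer_diag //.
rewrite subSnn addn1; case: ltnP => [h|_]; first by have := t_gt1 h; lia.
by lia.
Qed.

(** In the merged rows a jump in column j gives first_row (j + 1) - first_row j arcs besides the one
    counted by [num_jumps]; this surplus telescopes from a0 to m. *)
Lemma extension_count :
  \sum_(0 <= i < N) \sum_(0 <= j < N) extension i j.+1 = num_jumps + (m - a0).
Proof.
rewrite (@big_cat_nat _ _ _ m.+1) /=; [|lia|lia].
rewrite /num_jumps [in RHS]big_ltn; last by lia.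
have -> : \sum_(m.+1 <= i < N) \sum_(0 <= j < N) extension i j.+1 =
          \sum_(m.+1 <= i < N) \sum_(0 <= j < N) (i <= j) * jump i j.+1.
  apply: eq_big_nat => i /andP[mi iN]; apply: eq_big_nat => j /andP[_ jN].
  rewrite /extension mi ltnS jN /=.
  by case: (leqP i j) => ij; rewrite ?mul0n ?andbF // mul1n;
    congr (nat_of_bool _); apply/and4P/idP => [[]|->] //; split=> //; lia.
rewrite addnAC; congr (_ + _); rewrite exchange_big /=.
rewrite (@big_cat_nat _ _ _ m) /=; [|lia|lia].
rewrite [X in X + _]big_nat_cond [X in X + _]big1 ?add0n; last first.
  move=> j /andP[/andP[_ jm] _]; rewrite big_nat_cond big1 // => i _.
  by apply/eqP; rewrite eqb0; apply/negP => /and5P[_ _ h _ _]; lia.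
rewrite [in RHS](@big_cat_nat _ _ _ m) /=; [|lia|lia].
rewrite [X in _ = X + _ + _]big_nat_cond [X in _ = X + _ + _]big1 ?add0n; last first.
  by move=> j /andP[/andP[_ jm] _]; rewrite leqNgt jm.
have -> : m - a0 = \sum_(m <= j < N) (first_row j.+2 - first_row j.+1).
  rewrite (@telescope_sumn m N (fun j => first_row j.+1)); last first.
    by move=> j j' /subnKC <-; elim: (j' - j) => [|k IHk]; rewrite ?addn0 // addnS;
      apply: leq_trans IHk (first_row_mono _).
  by rewrite first_row_start first_row_end.
rewrite -big_split /=; apply: eq_big_nat => j /andP[mj jN].
have /andP[h1 h2] := first_row_range j.+1.
have /andP[h3 h4] := first_row_range j.+2.
have h5 := first_row_mono j.+1.
have -> : \sum_(0 <= i < m.+1) extension i j.+1 =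
    jump m j.+1 * \sum_(0 <= i < m.+1) (first_row j.+1 <= i <= first_row j.+2).
  rewrite big_distrr /=; apply: eq_big_nat => i /andP[_ im].
  have im' : (m < i) = false by lia.
  rewrite mulnb /extension im'; congr (nat_of_bool _).
  apply/idP/idP => [/and5P[] //|h]; rewrite h andbT.
  by case/and3P: h => _ h6 h7; apply/and4P; split; lia.
rewrite sum_interval // mj mul1n.
case Jj: (jump m j.+1); first by rewrite !mul1n; lia.
(* A column without a jump contains no arc of [P] in the merged rows, so the staircase does not rise
   there. *)
rewrite mul0n first_row_const ?subnn //.
  rewrite ltnS ltn_neqAle mj andbT; apply/eqP => e.
  by move: Jj; rewrite -e jump_first.
move=> i im; apply/negP => Pij; move/negP: Jj; apply.
apply: jump_arc => //; rewrite /collapse eqxx; apply/existsP.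
by exists (Ordinal (im : i < m.+1)).
Qed.

End Extension.

(** The difference [d] of the two functions [outer] vanishes on the first row, on the last column
    and on and below the diagonal. *)
Lemma num_jumps_const P1 P2 : admissible a0 m q N t P1 ->
  admissible a0 m q N t P2 -> num_jumps P1 = num_jumps P2.
Proof.
move=> adm1 adm2.
pose d i j : int := ((outer P1 i j)%:Z - (outer P2 i j)%:Z)%R.
have d_left j : d m j = 0%R by rewrite /d !outer_left // subrr.
have d_right i : d i N = 0%R by rewrite /d !outer_right subrr.
have d_diag i j : j <= i -> d i j = 0%R by move=> ji; rewrite /d !outer_diag ?subrr.
apply/eqP; rewrite -eqz_nat -subr_eq0 /num_jumps.
have toint (f : nat -> nat -> nat) : Posz (\sum_(m <= i < N) \sum_(0 <= j < N) f i j) =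
    (\sum_(m <= i < N) \sum_(0 <= j < N) (f i j)%:Z)%R.
  rewrite (big_morph Posz PoszD erefl); apply: eq_bigr => i _.
  exact: (big_morph Posz PoszD erefl).
rewrite !toint -sumrB.
under eq_bigr => i _ do rewrite -sumrB.
(* The difference of the jumps at (i, j + 1) is d (i + 1) j - d i (j + 1). Inserting d i j splits it
   into a difference in i and one in j, each of which telescopes to boundary values; below the
   diagonal all terms are 0. *)
have -> : (\sum_(m <= i < N) \sum_(0 <= j < N)
    (((i <= j) * jump P1 i j.+1)%N%:Z - ((i <= j) * jump P2 i j.+1)%N%:Z) =
  \sum_(m <= i < N) \sum_(0 <= j < N) ((d i.+1 j - d i j) - (d i j.+1 - d i j)))%R.
  apply: eq_big_nat => i /andP[mi iN]; apply: eq_big_nat => j /andP[_ jN].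
  case: (leqP i j) => ij; last first.
    by rewrite !mul0n !d_diag ?subrr //; lia.
  rewrite !mul1n /d.
  have := jump_nat P1 mi (ij : i < j.+1) jN.
  have := jump_nat P2 mi (ij : i < j.+1) jN => /= -> ->.
  rewrite !PoszD; lia.
under eq_bigr => i _ do rewrite sumrB.
rewrite sumrB exchange_big /= big_nat_cond big1 ?sub0r ?oppr_eq0; last first.
  move=> j /andP[/andP[_ jN] _];
  rewrite (@telescope_sumr _ m N (fun i => d i j)); last lia.
  by rewrite d_left d_diag ?subrr //; lia.
apply/eqP; rewrite big_nat_cond big1 // => i /andP[/andP[mi iN] _].
rewrite (@telescope_sumr _ 0 N (fun j => d i j)) // d_right d_diag ?subrr //.
Qed.

End Paths.

Local Open Scope ring_scope.

(** * Pfaffian identities *)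

Lemma lift_perm_surj n (i j : 'I_n.+1) (s : 'S_n.+1) :
  s i = j -> exists s' : 'S_n, s = lift_perm i j s'.
Proof.
move=> sij.
pose g k := odflt k (unlift j (s (lift i k))).
have gE k : lift j (g k) = s (lift i k).
  rewrite /g; case: unliftP => [k' -> //|/esym]; rewrite -sij => /perm_inj /eqP.
  by rewrite (negPf (neq_lift _ _)).
have g_inj : injective g.
  by move=> k l /(congr1 (lift j)); rewrite !gE => /perm_inj /lift_inj.
exists (perm g_inj); apply/permP=> k.
case: (unliftP i k) => [k' ->|->]; last by rewrite lift_perm_id.
by rewrite lift_perm_lift permE gE.
Qed.

Lemma lift_perm_inj n (i j : 'I_n.+1) : injective (@lift_perm n i j).
Proof.
move=> s s' e; apply/permP=> k; apply: (@lift_inj _ j).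
by rewrite -!(lift_perm_lift i) e.
Qed.

Section Pfaffian.
Variable R : comNzRingType.

(** The matching that pairs 0 with [js.1] + 1 and matches the remaining points by [js.2]. *)
Definition expand_perm t (js : 'I_(t.*2).+1 * 'S_(t.*2)) : 'S_(t.+1.*2) :=
  lift_perm ord0 ord0 (lift_perm ord0 js.1 js.2).

Lemma expand_perm_inj t : injective (@expand_perm t).
Proof.
move=> [j s] [j' s'] /lift_perm_inj /= e.
have jj' : j = j' by rewrite -(lift_perm_id ord0 j s) e lift_perm_id.
by rewrite -jj' in e *; rewrite (lift_perm_inj e).
Qed.

(** The point 0 cannot be the larger one of its pair, and the smaller points of the pairs increase,
    so 0 opens the first pair. *)
Lemma matching_perm0 t (s : 'S_(t.+1.*2)) : matching_perm s -> s ord0 = ord0.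
Proof.
case/andP=> /forallP s1 /forallP s2.
have [k sk] : exists k, s k = ord0 by exists (s^-1 ord0)%g; rewrite permKV.
have k2 : (k./2 < t.+1)%N by have := ltn_ord k; lia.
have [ok|ek] := boolP (odd k).
  have := s1 (Ordinal k2); rewrite (_ : odd_ord _ = k) ?sk //.
  by apply: val_inj; rewrite /= -[RHS]odd_double_half ok.
have ek' : k = even_ord (Ordinal k2).
  by apply: val_inj; rewrite /= -[LHS]odd_double_half (negPf ek).
have := forallP (s2 ord0) (Ordinal k2); rewrite -ek' sk ltn0 implybF.
rewrite -leqNgt leqn0 => /eqP /= k0.
by rewrite -[RHS]sk; congr (s _); apply: val_inj; rewrite ek' /= k0.
Qed.

Lemma expand_permE t (js : 'I_(t.*2).+1 * 'S_(t.*2)) :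
  [/\ expand_perm js (@even_ord t.+1 ord0) = ord0,
      expand_perm js (@odd_ord t.+1 ord0) = lift ord0 js.1,
      forall i : 'I_t, expand_perm js (@even_ord t.+1 (lift ord0 i))
        = lift ord0 (lift js.1 (js.2 (even_ord i))) &
      forall i : 'I_t, expand_perm js (@odd_ord t.+1 (lift ord0 i))
        = lift ord0 (lift js.1 (js.2 (odd_ord i)))].
Proof.
rewrite /expand_perm; split.
- by rewrite (_ : @even_ord t.+1 _ = ord0) ?lift_perm_id //; apply: val_inj.
- rewrite (_ : @odd_ord t.+1 _ = lift ord0 ord0) ?lift_perm_lift ?lift_perm_id //.
  exact: val_inj.
- move=> i; rewrite (_ : @even_ord t.+1 _ = lift ord0 (lift ord0 (even_ord i))).
    by rewrite !lift_perm_lift.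
  by apply: val_inj.
- move=> i; rewrite (_ : @odd_ord t.+1 _ = lift ord0 (lift ord0 (odd_ord i))).
    by rewrite !lift_perm_lift.
  by apply: val_inj.
Qed.

Lemma ltn_lift n (h : 'I_n.+1) (i j : 'I_n) : (lift h i < lift h j)%N = (i < j)%N.
Proof. by rewrite /= /bump; lia. Qed.

Lemma matching_expand_perm t (js : 'I_(t.*2).+1 * 'S_(t.*2)) :
  matching_perm (expand_perm js) = matching_perm js.2.
Proof.
have [e0 e1 e2 e3] := expand_permE js.
rewrite /matching_perm; congr (_ && _).
  apply/forallP/forallP => H i.
    by have := H (lift ord0 i); rewrite e2 e3 !ltn_lift.
  case: (unliftP ord0 i) => [i' ->|->]; first by rewrite e2 e3 !ltn_lift.
  by rewrite e0 e1.
apply/forallP/forallP => H i; apply/forallP => j.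
  by have := forallP (H (lift ord0 i)) (lift ord0 j); rewrite !e2 !ltn_lift.
case: (unliftP ord0 i) => [i' ->|->]; case: (unliftP ord0 j) => [j' ->|->] //.
  by have := forallP (H i') j'; rewrite !e2 !ltn_lift.
by rewrite e2 e0.
Qed.

(** Expansion along the first row: the normal forms are exactly the [expand_perm (j, s)] with s in
    normal form, and the two liftings contribute the sign (-1)^j. *)
Lemma pfaffian_expand t (A : 'M[R]_(t.+1.*2)) :
  pfaffian A = \sum_(j < (t.*2).+1) (-1) ^+ j * (A ord0 (lift ord0 j) *
    pfaffian (mxsub (fun k => lift ord0 (lift j k))
                    (fun k => lift ord0 (lift j k)) A)).
Proof.
have imE : [set s : 'S_(t.+1.*2) | matching_perm s] =
    [set expand_perm js | js in [set js : 'I_(t.*2).+1 * 'S_(t.*2) |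
       matching_perm js.2]].
  apply/setP => s; rewrite inE; apply/idP/imsetP => [ms|[js mjs ->]]; last first.
    by rewrite matching_expand_perm; rewrite inE in mjs.
  have [s' es'] := lift_perm_surj (matching_perm0 ms).
  have [s'' es''] := lift_perm_surj (erefl (s' ord0)).
  exists (s' ord0, s''); last by rewrite /expand_perm /= -es''.
  by rewrite inE -matching_expand_perm /expand_perm /= -es'' -es'.
rewrite /pfaffian (eq_bigl (fun s => s \in [set s : 'S_(t.+1.*2) | matching_perm s])) /=;
  last by move=> s; rewrite inE.
rewrite imE.
rewrite big_imset /=; last by move=> x y _ _; apply: expand_perm_inj.
rewrite (eq_bigl (fun js : 'I_(t.*2).+1 * 'S_(t.*2) => matching_perm js.2)) /=;
  last by move=> js; rewrite inE.
under [RHS]eq_bigr => j _ do rewrite big_distrr big_distrr /=.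
rewrite pair_big /=; apply: eq_bigr => -[j s] /= ms.
have [e0 e1 e2 e3] := expand_permE (j, s).
rewrite big_ord_recl e0 e1 /=.
under eq_bigr => i _ do rewrite e2 e3 /=.
under [in RHS]eq_bigr => i _ do rewrite mxE /=.
rewrite /expand_perm !odd_lift_perm /= signr_addb signr_odd.
rewrite -!mulrA; congr (_ * _).
by rewrite mulrCA.
Qed.

(* Exchanging the partners of 0 and 1 is a sign-reversing involution on the
   matchings that do not pair 0 with 1. *)
Lemma pfaffian_dup t (A : 'M[R]_(t.+1.*2)) :
  (forall k, A ord0 k = A (lift ord0 ord0) k) -> A ord0 (lift ord0 ord0) = 0 ->
  pfaffian A = 0.
Proof.
move=> dupA A01.
case: t A dupA A01 => [|t] A dupA A01.
  rewrite pfaffian_expand big_ord1; rewrite A01 mul0r mulr0 //.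
pose p1 : 'I_(t.+2.*2) := @odd_ord t.+2 ord0.
pose p2 : 'I_(t.+2.*2) := @even_ord t.+2 (lift ord0 ord0).
pose p3 : 'I_(t.+2.*2) := @odd_ord t.+2 (lift ord0 ord0).
pose F := fun s : 'S_(t.+2.*2) =>
  (-1) ^+ s * \prod_(i < t.+2) A (s (even_ord i)) (s (odd_ord i)).
(* If 1 is not the partner of 0, it is the smallest point outside the first pair and hence opens the
   second pair. *)
have one_at2 s : matching_perm s -> s p1 != lift ord0 ord0 -> s p2 = lift ord0 ord0.
  move=> ms s1n; have s00 := matching_perm0 ms.
  case/andP: ms => /forallP s1 /forallP s2.
  have [k sk] : exists k, s k = lift ord0 ord0.
    by exists (s^-1 (lift ord0 ord0))%g; rewrite permKV.
  have k2 : (k./2 < t.+2)%N by have := ltn_ord k; lia.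
  have [ok|ek] := boolP (odd k).
    have ek : odd_ord (Ordinal k2) = k.
      by apply: val_inj; rewrite /= -[RHS]odd_double_half ok.
    have := s1 (Ordinal k2); rewrite ek sk ltnS leqn0 => /eqP ev.
    have : even_ord (Ordinal k2) = ord0.
      by apply: (@perm_inj _ s); rewrite s00; apply: val_inj.
    move/(congr1 val) => /= k0; case/eqP: s1n; rewrite -sk; congr (s _).
    by apply: val_inj; rewrite -ek /= k0.
  have ek' : k = even_ord (Ordinal k2).
    by apply: val_inj; rewrite /= -[LHS]odd_double_half (negPf ek).
  have kn0 : (0 < k./2)%N.
    rewrite lt0n; apply/negP => /eqP k0.
    have kk : k = ord0 by apply: val_inj; rewrite ek' /= k0.
    by move: sk; rewrite kk s00 => /(congr1 val).
  have := forallP (s2 (lift ord0 ord0)) (Ordinal k2); rewrite -ek' sk /=.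
  have [k1|k1|k1] := ltngtP 1 k./2.
  - rewrite ltnS leqn0 => /eqP v0.
    have : p2 = ord0 by apply: (@perm_inj _ s); rewrite s00; apply: val_inj.
    by move/(congr1 val).
  - by move: kn0 k1; case: (k./2).
  - by move=> _; rewrite -sk; congr (s _); apply: val_inj; rewrite ek' /= -k1.
have neq13 : p1 != p3 by [].
pose T := fun s : 'S_(t.+2.*2) => (tperm p1 p3 * s)%g.
have T1 : forall u, T u p1 = u p3 by move=> u; rewrite /T permM tpermL.
have T3 : forall u, T u p3 = u p1 by move=> u; rewrite /T permM tpermR.
have Te : forall u i, T u (even_ord i) = u (even_ord i).
  move=> u i; rewrite /T permM tpermD //; rewrite -val_eqE /=; lia.
have To : forall u (i : 'I_t), T u (@odd_ord t.+2 (lift ord0 (lift ord0 i)))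
    = u (@odd_ord t.+2 (lift ord0 (lift ord0 i))).
  move=> u i; rewrite /T permM tpermD // -val_eqE /= /bump /=; lia.
have TK : involutive T by move=> u; rewrite /T mulgA tperm2 mul1g.
pose Q := fun s : 'S_(t.+2.*2) => matching_perm s && (s p1 != lift ord0 ord0).
have TQ : forall s, Q s -> Q (T s).
  move=> s; case/andP => ms s1; have s2 := one_at2 s ms s1; have s00 := matching_perm0 ms.
  apply/andP; split; last first.
    by rewrite T1 -s2; apply/eqP => /perm_inj /(congr1 val).
  move: (ms); case/andP => /forallP m1 /forallP m2; apply/andP; split; last first.
    by apply/forallP => i; apply/forallP => j; rewrite !Te; apply: (forallP (m2 i)).
  apply/forallP => i; rewrite Te.
  case: (unliftP ord0 i) => [i' ->|->].
    case: (unliftP ord0 i') => [i'' ->|->]; first by rewrite To; apply: m1.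
    rewrite -/p3 T3 -/p2 s2.
    have s1n0 : s p1 != ord0.
      by rewrite -s00; apply/eqP => /perm_inj /(congr1 val).
    by move: s1 s1n0; rewrite -!val_eqE /= /bump /=; lia.
  rewrite -/p1 T1 (_ : @even_ord t.+2 _ = ord0) ?s00; last by apply: val_inj.
  have := m1 (lift ord0 ord0); rewrite -/p2 s2 -/p3 /=; lia.
have QT : forall s, Q (T s) = Q s.
  move=> s; by apply/idP/idP => [/TQ|/TQ //]; rewrite TK.
have FT : forall s, Q s -> F (T s) = - F s.
  move=> s; case/andP => ms s1; have s2 := one_at2 s ms s1; have s00 := matching_perm0 ms.
  rewrite /F odd_permM odd_tperm neq13 signr_addb expr1 !mulN1r mulNr; congr (- _).
  congr (_ * _); rewrite !big_ord_recl.
  have e0 : even_ord (ord0 : 'I_t.+2) = ord0 by apply: val_inj.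
  rewrite !Te -/p1 -/p3 -/p2 T1 T3 e0 s00 s2 !dupA !mulrA.
  congr (_ * _); first by rewrite mulrC.
  by apply: eq_bigr => i _; rewrite Te To.
rewrite /pfaffian (bigID (fun s : 'S_(t.+2.*2) => s p1 != lift ord0 ord0)) /= -/F.
rewrite [X in _ + X]big1 ?addr0; last first.
  move=> s /andP[ms /negPn /eqP s1]; rewrite big_ord_recl -/p1 s1.
  rewrite (_ : @even_ord t.+2 _ = ord0) ?(matching_perm0 ms); last by apply: val_inj.
  by rewrite A01 mul0r mulr0.
(* The involution [T] exchanges the matchings with [s p1 < s p3] and the other ones. Cancelling
   these two halves avoids a division by 2 and so works in characteristic 2 as well. *)
rewrite (bigID (fun s : 'S_(t.+2.*2) => s p1 < s p3)%N) /=.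
rewrite [X in _ + X](reindex_inj (inv_inj TK)) /= -/F.
rewrite -[X in X + _ = _]opprK -sumrN; apply/eqP; rewrite addrC subr_eq0; apply/eqP.
apply: eq_big => [s|s].
  rewrite -/(Q _) -/(Q s) QT T1 T3 -leqNgt leq_eqVlt.
  by rewrite val_eqE (inj_eq perm_inj) (negPf neq13).
by case/andP; rewrite -/(Q _) QT -/(F (T s)) => /FT ->.
Qed.

(* This is the first-row expansion of the Pfaffian on the indices w_0, w_0, w_1, ... *)
Lemma pfaffian_syzygy t n (A : 'M[R]_n) (w : 'I_(t.*2).+1 -> 'I_n) :
  A (w ord0) (w ord0) = 0 ->
  \sum_(j < (t.*2).+1) (-1) ^+ j * (A (w ord0) (w j) *
    pfaffian (mxsub (w \o lift j) (w \o lift j) A)) = 0.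
Proof.
move=> A00.
(* [unlift] fails only at k = 0, where the default repeats w_0. *)
pose v (k : 'I_(t.+1.*2)) := w (odflt ord0 (unlift ord0 k)).
have vl k : v (lift ord0 k) = w k by rewrite /v liftK.
have v0 : v ord0 = w ord0 by rewrite /v unlift_none.
have pf0 : pfaffian (mxsub v v A) = 0.
  apply: pfaffian_dup => [k|]; first by rewrite !mxE vl v0.
  by rewrite mxE vl v0.
rewrite -[RHS]pf0 pfaffian_expand; apply: eq_bigr => j _.
rewrite mxE vl v0; congr (_ * (_ * pfaffian _)).
by apply/matrixP => k l; rewrite !mxE !vl.
Qed.

End Pfaffian.

(** * Initial monomials *)

Section Indices.
Variable n : nat.
Implicit Types a b : pfaffian_index n.

Definition pf_val a (k : nat) : nat := nth 0%N (map val (pf_idx a)) k.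

Lemma pf_valE a (i : 'I_(pf_half a).*2) : tnth (pf_idx a) i = pf_val a i :> nat.
Proof.
have lt_i : (i < size (pf_idx a))%N by rewrite size_tuple.
have x0 : 'I_n := tnth (pf_idx a) i.
by rewrite (tnth_nth x0) /pf_val (nth_map x0).
Qed.

Lemma pf_val_lt a k l :
  (k < l)%N -> (l < (pf_half a).*2)%N -> (pf_val a k < pf_val a l)%N.
Proof.
move=> kl l2.
have srt : sorted ltn (map val (pf_idx a)) by rewrite sorted_map; apply: pf_idx_sorted.
apply: (sorted_ltn_nth ltn_trans 0%N srt) => //;
  by rewrite inE size_map size_tuple // (ltn_trans kl).
Qed.

Lemma pf_val_ltn a k : (k < (pf_half a).*2)%N -> (pf_val a k < n)%N.
Proof. by move=> k2; rewrite -(pf_valE (Ordinal k2)). Qed.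

Lemma pf_val_ge a k l : (k + l < (pf_half a).*2)%N ->
  (pf_val a k + l <= pf_val a (k + l))%N.
Proof.
elim: l => [|l IHl]; first by rewrite !addn0.
rewrite !addnS => kl; apply: leq_ltn_trans (IHl (ltnW kl)) _.
exact: pf_val_lt.
Qed.

Lemma pf_leP a b : pf_le a b <-> (pf_half b <= pf_half a)%N /\
  forall k, (k < (pf_half b).*2)%N -> (pf_val a k <= pf_val b k)%N.
Proof.
split=> [] [ba le_ab]; split=> //; first move=> k kb; last first.
    by move=> i j ij; rewrite !pf_valE ij; apply: le_ab.
  have ka : (k < (pf_half a).*2)%N by rewrite (leq_trans kb) // leq_double.
  by have := le_ab (Ordinal ka) (Ordinal kb) erefl; rewrite !pf_valE.
Qed.

Section Make.
Variables (t : nat) (t_gt0 : (0 < t)%N) (h : 'I_(t.*2) -> 'I_n).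
Hypothesis h_mono : {homo h : i j / (i < j)%N}.

Lemma mk_index_sorted : sorted (fun i j : 'I_n => (i < j)%N) [tuple h i | i < t.*2].
Proof.
rewrite /= sorted_map.
apply: (@sub_sorted _ (relpre val ltn)) => [i j|]; first exact: h_mono.
by rewrite -sorted_map val_enum_ord iota_ltn_sorted.
Qed.

Definition mk_index := PfaffianIndex t_gt0 mk_index_sorted.

Lemma mk_index_poly (K : fieldType) :
  pf_poly K mk_index = pfaffian (mxsub h h (generic_skew_mx K n)).
Proof.
by congr pfaffian; apply/matrixP => i j; rewrite !mxE !tnth_mktuple.
Qed.

Lemma mk_index_val (i : 'I_(t.*2)) : pf_val mk_index i = h i.
Proof. by rewrite -(@pf_valE mk_index i) tnth_mktuple. Qed.

End Make.

Lemma exists_index (s : nat) (f : nat -> nat) : (0 < s)%N ->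
  (forall k l, (k < l)%N -> (l < s.*2)%N -> (f k < f l)%N) ->
  (forall k, (k < s.*2)%N -> (f k < n)%N) ->
  exists b, pf_half b = s /\ forall k, (k < s.*2)%N -> pf_val b k = f k.
Proof.
move=> s0 f_mono f_lt.
pose h (i : 'I_(s.*2)) : 'I_n := Ordinal (f_lt i (ltn_ord i)).
have h_mono : {homo h : i j / (i < j)%N}.
  by move=> i j ij /=; apply: f_mono.
exists (mk_index s0 h_mono); split=> // k ks.
exact: (mk_index_val s0 h_mono (Ordinal ks)).
Qed.

End Indices.

Section Monomials.
Variables (K : fieldType) (n : nat).
Implicit Types (a b : pfaffian_index n) (p : Xplus n) (Z : {set Xplus n}).

Lemma XmonE (i j : 'I_n) p : (i < j)%N ->
  Xmon i j (enum_rank p) = ((i, j) == val p).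
Proof.
move=> ij; rewrite /Xmon insubT mnm1E (inj_eq enum_rank_inj).
by rewrite -val_eqE.
Qed.

Lemma antidiagonal_monomialE a p : antidiagonal_monomial a (enum_rank p) =
  (\sum_(i < pf_half a)
    ((pf_val a i == (val p).1) && (pf_val a ((pf_half a).*2 - i.+1) == (val p).2)))%N.
Proof.
rewrite /antidiagonal_monomial mnm_sumE; apply: eq_bigr => i _.
rewrite XmonE; last by rewrite !pf_valE pf_val_lt //= ; have := ltn_ord i; lia.
rewrite -pair_eqE /= -!val_eqE /= !pf_valE //=.
Qed.

Definition has_arc (Z : {set Xplus n}) (i j : nat) : bool :=
  [exists p in Z, ((val p).1 == i :> nat) && ((val p).2 == j :> nat)].

Lemma antidiagonal_monomial_gt0 a p : (0 < antidiagonal_monomial a (enum_rank p))%N ->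
  exists2 i, (i < pf_half a)%N &
    pf_val a i = (val p).1 /\ pf_val a ((pf_half a).*2 - i.+1) = (val p).2.
Proof.
rewrite antidiagonal_monomialE lt0n sum_nat_eq0 negb_forall => /existsP[i].
by rewrite eqb0 negbK => /andP[/eqP e1 /eqP e2]; exists i.
Qed.

Lemma arc_exists a i : (i < pf_half a)%N ->
  exists p, (val p).1 = pf_val a i :> nat /\
    (val p).2 = pf_val a ((pf_half a).*2 - i.+1) :> nat.
Proof.
move=> ia.
have l1 : (i < (pf_half a).*2)%N by lia.
have l2 : ((pf_half a).*2 - i.+1 < (pf_half a).*2)%N by lia.
have lt : (Ordinal (pf_val_ltn l1) < Ordinal (pf_val_ltn l2))%N.
  by apply: pf_val_lt; lia.
by exists (Sub (Ordinal (pf_val_ltn l1), Ordinal (pf_val_ltn l2)) lt).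
Qed.

(** The left ends of the arcs are distinct, so the initial monomial is squarefree. *)
Lemma antidiagonal_monomial_arc a i p : (i < pf_half a)%N ->
  (val p).1 = pf_val a i :> nat ->
  (val p).2 = pf_val a ((pf_half a).*2 - i.+1) :> nat ->
  antidiagonal_monomial a (enum_rank p) = 1%N.
Proof.
move=> ia p1 p2; rewrite antidiagonal_monomialE (bigD1 (Ordinal ia)) //=.
rewrite p1 p2 !eqxx /= big1 // => j jni.
case: eqP => //= e; case/eqP: jni; apply: val_inj => /=.
have := ltn_ord j.
by case: (ltngtP j i) => // [ji|ij] jn;
  have := @pf_val_lt _ a _ _ _ _; [move/(_ j i)|move/(_ i j)]; lia.
Qed.

Definition set_monomial (Z : {set Xplus n}) : 'X_{1..nvars n} :=
  [multinom (enum_val k \in Z : nat) | k < nvars n]%MM.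

Lemma set_monomialE Z : \prod_(p in Z) Xvar K p = 'X_[set_monomial Z].
Proof.
rewrite /Xvar -(big_morph (mpolyX K) (@mpolyXD _ _) (mpolyX0 _ _)).
congr 'X_[_]; apply/mnmP => k; rewrite mnm_sumE mnmE.
rewrite (eq_bigr (fun p => (p == enum_val k) : nat)); last first.
  by move=> p _; rewrite mnm1E -(inj_eq enum_val_inj) enum_rankK.
case: (boolP (enum_val k \in Z)) => kZ.
  by rewrite (bigD1 _ kZ) /= eqxx big1 // => p /andP[_ /negPf ->].
by rewrite big1 // => p pZ; apply/eqP; rewrite eqb0; apply: contraNneq kZ => <-.
Qed.

Definition arcs_in (P : nat -> nat -> bool) a : Prop :=
  forall i, (i < pf_half a)%N -> P (pf_val a i) (pf_val a ((pf_half a).*2 - i.+1)).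

Lemma arcs_in_set Z a :
  (antidiagonal_monomial a <= set_monomial Z)%MM <-> arcs_in (has_arc Z) a.
Proof.
split=> [/mnm_lepP le_aZ i ia|aZ].
  have [p [p1 p2]] := arc_exists ia.
  have := le_aZ (enum_rank p).
  rewrite (antidiagonal_monomial_arc ia p1 p2) mnmE enum_rankK lt0b => pZ.
  by apply/existsP; exists p; rewrite pZ p1 p2 !eqxx.
apply/mnm_lepP => k; rewrite -[k]enum_valK; set p := enum_val k.
case: (posnP (antidiagonal_monomial a (enum_rank p))) => [-> //|].
case/antidiagonal_monomial_gt0 => i ia [p1 p2].
rewrite (antidiagonal_monomial_arc ia (esym p1) (esym p2)) mnmE enum_rankK lt0b.
case/existsP: (aZ i ia) => q /and3P[qZ /eqP q1 /eqP q2].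
suff -> : p = q by [].
apply: val_inj; rewrite [LHS]surjective_pairing [RHS]surjective_pairing.
by congr (_, _); apply: val_inj; rewrite /= ?q1 ?q2 ?p1 ?p2.
Qed.

End Monomials.

(** * Monomials in initial ideals *)

Section InitialIdeals.
Variables (K : fieldType) (N : nat) (le : rel 'X_{1..N}).
Implicit Types (G I : {mpoly K[N]} -> Prop).

(** The monomial occurs in at least one summand, hence is a multiple of the generator in that
    summand. *)
Lemma initial_ideal_ofX G m : initial_ideal_of le G 'X_[m] ->
  exists g mg, [/\ G g, initial_monomial le g mg & (mg <= m)%MM].
Proof.
case=> s [sG eX].
have : 'X_[m]@_m != 0 :> K by rewrite mcoeffX eqxx oner_neq0.
rewrite eX raddf_sum /= => nz.
have [cg cgs nzcg] : exists2 cg, cg \in s & (cg.1 * cg.2)@_m != 0.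
  apply/hasP; apply: contraNT nz => /hasPn z.
  by rewrite big_seq big1 // => cg /z; rewrite negbK => /eqP.
have [g [mg [Gg ig e2]]] := sG _ cgs.
exists g, mg; split=> //.
move: nzcg; rewrite e2 -mcoeff_msupp => /msuppM_le /allpairsP[[m1 m2] /= [_]].
by rewrite msuppX inE => /eqP -> ->; apply: lem_addl.
Qed.

Lemma initial_ideal_of_multiple G g mg m : G g -> initial_monomial le g mg ->
  (mg <= m)%MM -> initial_ideal_of le G 'X_[m].
Proof.
move=> Gg ig le_mg; exists [:: ('X_[m - mg], 'X_[mg])]; split; last first.
  by rewrite big_seq1 /= -mpolyXD submK.
by move=> cg; rewrite inE => /eqP ->; exists g, mg.
Qed.

Lemma initial_monomial_uniq (f : {mpoly K[N]}) m1 m2 : term_order le ->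
  initial_monomial le f m1 -> initial_monomial le f m2 -> m1 = m2.
Proof.
move=> T [s1 l1] [s2 l2]; apply: (term_order_anti T).
by rewrite l2 // l1.
Qed.

End InitialIdeals.

Lemma ideal_gen_mem (R : comNzRingType) (S : R -> Prop) g : S g -> ideal_gen S g.
Proof.
move=> Sg; exists [:: (1, g)]; split; last by rewrite big_seq1 mul1r.
by move=> cg; rewrite inE => /eqP ->.
Qed.

(** * Faces of the complex as sets of arcs *)

Section Delta.
Variables (K : fieldType) (n : nat) (alpha : pfaffian_index n).
Variable le : rel 'X_{1..nvars n}.
Hypothesis le_anti : antidiagonal K le.

(** The double negation comes from [Delta] being a negation; [pf_le_dec] removes it later. *)
Lemma Delta_pf_le Z b : Delta K le alpha Z -> arcs_in (has_arc Z) b ->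
  ~ ~ pf_le alpha b.
Proof.
move=> DZ /arcs_in_set bZ nle; apply: DZ; rewrite set_monomialE.
apply: (initial_ideal_of_multiple _ (le_anti.2 b) bZ).
by apply: ideal_gen_mem; exists b.
Qed.

Lemma groebner_divides : G_pfaffian K alpha -> forall (f : pfring K n) m,
  cogenerated_ideal alpha f -> initial_monomial le f m ->
  exists2 b, ~ pf_le alpha b & (antidiagonal_monomial b <= m)%MM.
Proof.
move=> G f m If ifm.
have [_ /(_ 'X_[m]) [H _]] := G le le_anti.
have /H/initial_ideal_ofX[g [mg [[b [nle ->]] ig le_mg]]] :=
  initial_ideal_of_multiple If ifm (lepm_refl m).
exists b => //.
by rewrite (initial_monomial_uniq le_anti.1 (le_anti.2 b) ig).
Qed.

Lemma Delta_intro Z : G_pfaffian K alpha ->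
  (forall b, arcs_in (has_arc Z) b -> pf_le alpha b) -> Delta K le alpha Z.
Proof.
move=> G HZ; rewrite /Delta set_monomialE.
have [_ H] := G le le_anti => /H /initial_ideal_ofX[g [mg [[b [nle ->]] ig le_mg]]].
apply: nle; apply: HZ; apply/arcs_in_set.
by rewrite (initial_monomial_uniq le_anti.1 (le_anti.2 b) ig).
Qed.

End Delta.

(** * The middle indices of a G-Pfaffian are consecutive *)

Lemma total_max (I : eqType) (T : Type) (le : rel T) (mu : I -> T) (x : I) (s : seq I) :
  total le -> transitive le ->
  exists2 y, y \in x :: s & forall z, z \in x :: s -> le (mu z) (mu y).
Proof.
move=> tot tr; elim: s x => [|y s IHs] x.
  exists x; rewrite ?mem_head // => z; rewrite inE => /eqP ->.
  by have := tot (mu x) (mu x); rewrite orbb.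
have [m ms mm] := IHs y.
have [xm|mx] := orP (tot (mu x) (mu m)).
  by exists m => [|z]; rewrite inE ?ms ?orbT // => /orP[/eqP ->|/mm].
exists x; rewrite ?mem_head // => z; rewrite inE => /orP[/eqP ->|/mm zm].
  by have := tot (mu x) (mu x); rewrite orbb.
exact: tr zm mx.
Qed.

Section Gap.
Variables (K : fieldType) (n : nat) (alpha : pfaffian_index n).
Variable le : rel 'X_{1..nvars n}.
Hypothesis le_anti : antidiagonal K le.
Local Notation t := (pf_half alpha).
Local Notation a := (pf_val alpha).
Variable p : nat.
Hypotheses (p_ge2 : (2 <= p)%N) (p_lt : (p.+1 < t.*2)%N).
Hypothesis gap : ((a p.-1).+1 < a p)%N.

(* The sequence w: alpha with a_p - 1 inserted at position p. *)
Definition gap_val (k : nat) : nat :=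
  if (k < p)%N then a k else if k == p then (a p).-1 else a k.-1.

Lemma gap_val_lt k l : (k < l)%N -> (l <= t.*2)%N -> (gap_val k < gap_val l)%N.
Proof.
move=> kl lt; rewrite /gap_val.
have ap k' : (k' < p)%N -> (a k' <= a p.-1)%N.
  move=> k'p; case: (ltngtP k' p.-1) => [h|h|-> //]; last by lia.
  by apply/ltnW/pf_val_lt; lia.
have pa k' : (p <= k')%N -> (k' < t.*2)%N -> (a p <= a k')%N.
  rewrite leq_eqVlt => /orP[/eqP -> //|h h']; apply/ltnW/pf_val_lt; lia.
case: (ltngtP k p) => kp; case: (ltngtP l p) => lp; try lia.
- apply: pf_val_lt; lia.
- have := ap k kp; have := pa l.-1; lia.
- have := ap k kp; lia.
- apply: pf_val_lt; lia.
- have := pa l.-1; lia.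
Qed.

Lemma gap_val_inj k l : (k <= t.*2)%N -> (l <= t.*2)%N ->
  gap_val k = gap_val l -> k = l.
Proof.
move=> kt lt e; case: (ltngtP k l) => // [kl|lk].
  by have := gap_val_lt kl lt; rewrite e ltnn.
by have := gap_val_lt lk kt; rewrite e ltnn.
Qed.

(** It suffices to take l = k + 1, where w_(k+1) is a_(k+1), a_p - 1 or a_k according to the
    position of k + 1 relative to p. *)
Lemma gap_val_ge k l : (k < l)%N -> (l <= t.*2)%N -> (a k <= gap_val l)%N.
Proof.
move=> kl lt; apply: (@leq_trans (gap_val k.+1)); last first.
  case: (ltngtP k.+1 l) => [h|h|-> //]; last by lia.
  exact/ltnW/gap_val_lt.
rewrite /gap_val /=; case: (ltngtP k.+1 p) => h //.
  by apply/ltnW/pf_val_lt; lia.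
have -> : k = p.-1 by lia.
lia.
Qed.

Lemma gap_val_ltn (k : 'I_(t.*2).+1) : (gap_val k < n)%N.
Proof.
have := ltn_ord k; rewrite /gap_val => kt.
have pn : (a p < n)%N by apply: pf_val_ltn; lia.
case: (ltngtP k p) => kp; try (apply: pf_val_ltn; lia).
lia.
Qed.

Definition gap_idx (k : 'I_(t.*2).+1) : 'I_n := Ordinal (gap_val_ltn k).

Lemma gap_idx_mono j : {homo gap_idx \o lift j : k l / (k < l)%N}.
Proof.
move=> k l kl /=; apply: gap_val_lt; first by rewrite (ltn_lift j).
by have := ltn_ord (lift j l).
Qed.

Definition gap_pf j := mk_index (pf_half_gt0 alpha) (@gap_idx_mono j).

Lemma gap_pfE j k : (k < t.*2)%N -> pf_val (gap_pf j) k = gap_val (bump j k).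
Proof.
move=> kt.
by have := mk_index_val (pf_half_gt0 alpha) (@gap_idx_mono j) (Ordinal kt).
Qed.

Definition syzygy_term (j : 'I_(t.*2).+1) : pfring K n :=
  (-1) ^+ j * (generic_skew_mx K n (gap_idx ord0) (gap_idx j) * pf_poly K (gap_pf j)).

Lemma sum_syzygy_term : \sum_j syzygy_term j = 0.
Proof.
rewrite -[RHS](@pfaffian_syzygy _ t n (generic_skew_mx K n) gap_idx); last first.
  by rewrite mxE ltnn.
by apply: eq_bigr => j _; rewrite /syzygy_term mk_index_poly.
Qed.

Lemma syzygy_term0 : syzygy_term ord0 = 0.
Proof. by rewrite /syzygy_term mxE ltnn mul0r mulr0. Qed.

Definition syzygy_tail : pfring K n := \sum_(j < (t.*2).+1 | (p < j)%N) syzygy_term j.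

(** The whole sum is 0, and its term j = 0 has the factor X_(w_0 w_0) = 0. *)
Lemma syzygy_tail_head :
  syzygy_tail = - \sum_(j < (t.*2).+1 | (0 < j <= p)%N) syzygy_term j.
Proof.
apply/eqP; rewrite -subr_eq0 opprK; apply/eqP.
rewrite -[RHS]sum_syzygy_term.
rewrite [RHS](bigID (fun j : 'I_(t.*2).+1 => p < j)%N) /=.
rewrite -/syzygy_tail; congr (_ + _).
rewrite [RHS](bigID (fun j : 'I_(t.*2).+1 => 0 < j)%N) /=.
rewrite [X in _ = _ + X]big1 ?addr0.
  by apply: eq_bigl => j; rewrite -leqNgt andbC.
move=> j /andP[_]; rewrite -leqNgt leqn0 => /eqP j0.
by rewrite (_ : j = ord0) ?syzygy_term0 //; apply: val_inj.
Qed.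

(** Removing an entry behind position p leaves a_p - 1 at position p. *)
Lemma gap_pf_not_ge (j : 'I_(t.*2).+1) : (p < j)%N -> ~ pf_le alpha (gap_pf j).
Proof.
move=> pj /pf_leP[_ /(_ p)]; have -> : pf_val (gap_pf j) p = (a p).-1.
  rewrite gap_pfE; last by lia.
  by rewrite (_ : bump j p = p) /gap_val ?ltnn ?eqxx // /bump; lia.
rewrite /=; lia.
Qed.

Lemma syzygy_tail_in : cogenerated_ideal alpha syzygy_tail.
Proof.
exists [seq ((-1) ^+ (j : 'I_(t.*2).+1) * generic_skew_mx K n (gap_idx ord0) (gap_idx j),
             pf_poly K (gap_pf j)) |
           j : 'I_(t.*2).+1 <- [seq j : 'I_(t.*2).+1 <- index_enum _ | (p < j)%N]].
split.
  move=> cg /mapP[j]; rewrite mem_filter => /andP[pj _] ->.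
  by exists (gap_pf j); split=> //; apply: gap_pf_not_ge.
rewrite big_map big_filter /syzygy_tail; apply: eq_bigr => j _ /=.
by rewrite /syzygy_term mulrA.
Qed.

Definition term_init (j : 'I_(t.*2).+1) : 'X_{1..nvars n} :=
  (Xmon (gap_idx ord0) (gap_idx j) + antidiagonal_monomial (gap_pf j))%MM.

Lemma syzygy_term_coeff (j : 'I_(t.*2).+1) m : (0 < j)%N ->
  ((syzygy_term j)@_m != 0) =
  (('X_[Xmon (gap_idx ord0) (gap_idx j)] * pf_poly K (gap_pf j))@_m != 0).
Proof.
move=> j0; rewrite /syzygy_term mxE gap_val_lt //; last first.
  by have := ltn_ord j; rewrite ltnS.
rewrite -signr_odd; case: (odd j); rewrite ?expr0 ?mul1r //.
by rewrite expr1 mulN1r mcoeffN oppr_eq0.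
Qed.

Lemma syzygy_term_initial (j : 'I_(t.*2).+1) : (0 < j)%N ->
  initial_monomial le (syzygy_term j) (term_init j).
Proof.
move=> j0; have [s1 l1] := le_anti.2 (gap_pf j); split.
  rewrite mcoeff_msupp syzygy_term_coeff // mulrC /term_init addmC.
  by rewrite [(_ + Xmon _ _)%MM]addmC mcoeffMX -mcoeff_msupp.
move=> m; rewrite mcoeff_msupp syzygy_term_coeff // -mcoeff_msupp.
move=> /msuppM_le /allpairsP[[m1 m2] /= []].
rewrite msuppX inE => /eqP -> /l1 le2 ->.
exact: (term_order_mul le_anti.1).
Qed.

Lemma term_init_gt0 (j : 'I_(t.*2).+1) (q : Xplus n) : (0 < j)%N ->
  (0 < term_init j (enum_rank q))%N ->
  (gap_val 0 = (val q).1 /\ gap_val j = (val q).2) \/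
  exists2 i, (i < t)%N & gap_val (bump j i) = (val q).1 /\
    gap_val (bump j (t.*2 - i.+1)) = (val q).2.
Proof.
move=> j0; rewrite mnmDE addn_gt0 => /orP[|].
  rewrite XmonE; last first.
    by apply: gap_val_lt => //; have := ltn_ord j; rewrite ltnS.
  by rewrite lt0b => /eqP <-; left.
case/antidiagonal_monomial_gt0 => i; rewrite [pf_half _]/= => it.
rewrite !gap_pfE; [|lia|lia] => e.
by right; exists i.
Qed.

(** The arc (w_0, w_j) divides the monomial of i. If it came from in(Pf(w \ w_i)), it would be the
    outermost arc there and end at one of the last two entries of w, whereas j <= p <= 2t - 2. *)
Lemma term_init_inj (i j : 'I_(t.*2).+1) : (0 < i)%N -> (0 < j <= p)%N ->
  term_init i = term_init j -> i = j.
Proof.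
move=> i0 /andP[j0 jp] e.
have lt : (gap_idx ord0 < gap_idx j)%N by apply: gap_val_lt => //=; lia.
have : (0 < term_init i (enum_rank (Sub (gap_idx ord0, gap_idx j) lt : Xplus n)))%N.
  by rewrite e mnmDE addn_gt0 XmonE // eqxx.
have := ltn_ord i; have := ltn_ord j => jt it.
move/(term_init_gt0 i0) => [[_ /= /gap_val_inj h]|[k kt [/= e1 e2]]].
  by apply: val_inj; apply: h; lia.
have k0 : bump i k = 0%N by apply: gap_val_inj e1; rewrite /bump; lia.
have k1 : bump i (t.*2 - k.+1) = j by apply: gap_val_inj e2; rewrite /bump; lia.
move: k0 k1; rewrite /bump; lia.
Qed.

(** The terms with 0 < j <= p have distinct initial monomials, so the largest of these cannot
    cancel. *)
Lemma syzygy_tail_initial : exists2 j : 'I_(t.*2).+1,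
  (0 < j <= p)%N & initial_monomial le syzygy_tail (term_init j).
Proof.
have pt : (p < (t.*2).+1)%N by lia.
(* [Ordinal pt] is j = p, a first element that makes the list of candidates nonempty. *)
pose s := [seq j : 'I_(t.*2).+1 <- enum 'I_(t.*2).+1 | (0 < j <= p)%N].
have sE j : (j \in Ordinal pt :: s) = (0 < j <= p)%N.
  rewrite inE mem_filter mem_enum andbT; case: eqP => [->|] //=; lia.
have T := le_anti.1.
have [j] := total_max term_init (Ordinal pt) s (term_order_total T) (term_order_trans T).
rewrite sE => jp jmax; exists j => //; split.
  rewrite mcoeff_msupp syzygy_tail_head mcoeffN oppr_eq0 raddf_sum /=.
  rewrite (bigD1 j) //= big1 ?addr0.
    by have [] := @syzygy_term_initial j; [case/andP: jp|rewrite mcoeff_msupp].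
  move=> i /andP[ip inj]; apply: contraNeq inj => nz.
  have i0 : (0 < i)%N by case/andP: ip.
  have [_ li] := syzygy_term_initial i0.
  apply/eqP/term_init_inj => //; apply: (term_order_anti T).
  by rewrite jmax ?sE //= li // mcoeff_msupp.
move=> m; rewrite mcoeff_msupp syzygy_tail_head mcoeffN oppr_eq0 raddf_sum /= => nz.
have [i ip nzi] : exists2 i : 'I_(t.*2).+1, (0 < i <= p)%N & (syzygy_term i)@_m != 0.
  apply/exists_inP; apply: contraNT nz; rewrite negb_exists => /forallP z.
  rewrite big1 // => i ip; have := z i; rewrite /in_mem /= ip /= negbK => /eqP.
  by [].
have i0 : (0 < i)%N by case/andP: ip.
have [_ li] := syzygy_term_initial i0.
apply: (term_order_trans T) (jmax i _); last by rewrite sE.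
by apply: li; rewrite mcoeff_msupp.
Qed.

(** Every arc of b is (w_0, w_j) or an arc of w \ w_j, so b_k = w_x for some x >= k. This gives b_k
    >= a_k unless x = k >= p, a case that the shape of the arcs excludes. *)
Lemma divides_term_init (j : 'I_(t.*2).+1) b : (0 < j <= p)%N ->
  (antidiagonal_monomial b <= term_init j)%MM -> pf_le alpha b.
Proof.
move=> /andP[j0 jp] /mnm_lepP le_bj.
set s := pf_half b; set v := pf_val b.
have jt := ltn_ord j.
have arc i : (i < s)%N -> (v i = gap_val 0 /\ v (s.*2 - i.+1)%N = gap_val j) \/
    exists2 k, (k < t)%N & v i = gap_val (bump j k) /\
      v (s.*2 - i.+1)%N = gap_val (bump j (t.*2 - k.+1)).
  move=> ib; have [q [q1 q2]] := arc_exists ib.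
  have := le_bj (enum_rank q).
  rewrite (antidiagonal_monomial_arc ib q1 q2) => /(term_init_gt0 j0).
  by rewrite q1 q2 -/v -/s => -[[e1 e2]|[k kt [e1 e2]]]; [left|right; exists k].
have val_in k : (k < s.*2)%N -> exists2 x, (x <= t.*2)%N & v k = gap_val x.
  move=> ks; case: (ltnP k s) => [ks'|sk].
    case: (arc k ks') => [[-> _]|[x xt [-> _]]]; first by exists 0%N.
    by exists (bump j x) => //; rewrite /bump; lia.
  have k's : (s.*2 - k.+1 < s)%N by lia.
  have kE : (s.*2 - (s.*2 - k.+1).+1 = k)%N by lia.
  case: (arc _ k's) => [[_]|[x xt [_]]]; rewrite kE => ->.
    by exists j => //; rewrite -ltnS.
  by exists (bump j (t.*2 - x.+1)) => //; rewrite /bump; lia.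
have rank k : (k < s.*2)%N -> exists2 x, (k <= x <= t.*2)%N & v k = gap_val x.
  elim: k => [|k IHk] ks; first by have [x xt ->] := val_in _ ks; exists x.
  have [x /andP[kx xt] ex] := IHk (ltnW ks); have [y yt ey] := val_in _ ks.
  exists y => //; rewrite yt andbT; apply: leq_ltn_trans kx _; rewrite ltnNge.
  apply/negP => yx; have := @pf_val_lt _ b k k.+1 (ltnSn _) ks.
  rewrite -/v ex ey ltnNge => /negP; apply.
  move: yx; rewrite leq_eqVlt => /orP[/eqP -> //|yx].
  exact/ltnW/gap_val_lt.
have s_le : (s <= t)%N.
  have s0 : (0 < s)%N by exact: pf_half_gt0.
  have [|x xt _] := rank s.*2.-1; first lia.
  lia.
apply/pf_leP; split=> // k ks; rewrite -/v.
have [x /andP[kx xt] ex] := rank k ks.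
case: (ltngtP k x) kx => // [kx|kx] _; first by rewrite ex; apply: gap_val_ge.
case: (ltnP k p) => [kp|pk]; first by rewrite ex -kx /gap_val kp.
(* Now b_k = w_k with k >= p. As b_i = w_x requires x >= i, descending from k shows that b begins
   with w_0, ..., w_k, among which are w_0 and w_j. *)
exfalso; rewrite -kx in ex xt.
have init y : (y <= k)%N -> v y = gap_val y.
  move=> yk; rewrite -(subKn yk); elim: (k - y)%N (leq_subr y k) => [|d IHd] dk.
    by rewrite subn0.
  have IH := IHd (ltnW dk).
  have [|z /andP[dz zt] ez] := rank (k - d.+1)%N; first lia.
  have := @pf_val_lt _ b (k - d.+1)%N (k - d)%N; rewrite -/v IH ez => lt.
  suff -> : z = (k - d.+1)%N by [].
  case: (ltngtP z (k - d.+1)%N) dz => // dz _.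
  have {}lt : (gap_val z < gap_val (k - d))%N by apply: lt; lia.
  suff : (z < k - d)%N by lia.
  rewrite ltnNge; apply: contraL lt; rewrite -leqNgt leq_eqVlt.
  by case/orP => [/eqP -> //|h]; apply/ltnW/gap_val_lt.
have v_inj i l : (i < s.*2)%N -> (l < s.*2)%N -> v i = v l -> i = l.
  move=> is2 ls2 e; case: (ltngtP i l) => // h.
    by have := @pf_val_lt _ b _ _ h ls2; rewrite -/v e ltnn.
  by have := @pf_val_lt _ b _ _ h is2; rewrite -/v e ltnn.
have s0 : (0 < s)%N by lia.
have s1 : (1 < s)%N by lia.
(* If the first arc of b is (w_0, w_j), then w_j is the last entry of b and j = k = p = 2s - 1. The
   second arc (w_1, w_(2s-2)) must then be the second arc of w \ w_j, so that s = t and p = 2t - 1,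
   which is too large. *)
case: (arc 0%N s0) => [[_ e1]|[i it [e1 e2]]].
  have [|y /andP[sy yt] ey] := rank (s.*2 - 1)%N; first lia.
  have yj : y = j by apply: gap_val_inj; rewrite // -?ey ?e1; lia.
  have jk : j = k :> nat by lia.
  have jp' : j = p :> nat by lia.
  case: (arc 1%N s1) => [[e3 _]|[i it [e3 e4]]].
    by have := init 1%N; rewrite e3 => /(_ _) /gap_val_inj => /(_ _ _ _); lia.
  have v1 : v 1%N = gap_val 1 by apply: init; lia.
  have v2 : v (s.*2 - 2)%N = gap_val (s.*2 - 2) by apply: init; lia.
  have h1 : 1%N = bump j i by apply: gap_val_inj; rewrite ?/bump -?v1 //; lia.
  have h2 : (s.*2 - 2)%N = bump j (t.*2 - i.+1).
    by apply: gap_val_inj; rewrite -?v2 // /bump; lia.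
  by move: h1 h2; rewrite /bump; lia.
(* Otherwise the first arc of b is the outermost arc of w \ w_j. The entry w_j = b_j needs an arc as
   well: arcs of w \ w_j avoid it, and (w_0, w_j) would share w_0 with the first arc. *)
have v0 : v 0%N = gap_val 0 by apply: init.
have i0 : 0%N = bump j i by apply: gap_val_inj; rewrite -?v0 // /bump; lia.
have i0' : i = 0%N by move: i0; rewrite /bump; lia.
have vj : v j = gap_val j by apply: init; lia.
case: (ltnP j s) => js.
  case: (arc j js) => [[e3 _]|[l lt [e3 _]]].
    have := @v_inj j 0%N; rewrite e3 v0; lia.
  have : (j : nat) = bump j l by apply: gap_val_inj; rewrite -?vj // /bump; lia.
  by apply/eqP/neq_bump.
have js' : (s.*2 - j.+1 < s)%N by lia.
have jE : (s.*2 - (s.*2 - j.+1).+1 = j)%N by lia.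
case: (arc _ js') => [[e3 _]|[l lt [_]]].
  have := @v_inj (s.*2 - j.+1)%N 0%N; rewrite e3 v0 => /(_ _ _ erefl) h.
  have j_last : (s.*2 - 1 = j)%N by lia.
  have : bump j (t.*2 - i.+1) = j.
    by apply: gap_val_inj; rewrite -?vj -?e2 ?j_last // /bump; lia.
  by apply/eqP; rewrite eq_sym neq_bump.
rewrite jE vj => /gap_val_inj h.
have : (j : nat) = bump j (t.*2 - l.+1) by apply: h; rewrite /bump; lia.
by apply/eqP/neq_bump.
Qed.

End Gap.

Lemma G_pfaffian_consecutive (K : fieldType) n (alpha : pfaffian_index n)
    (le : rel 'X_{1..nvars n}) p :
  antidiagonal K le -> G_pfaffian K alpha ->
  (2 <= p)%N -> (p.+1 < (pf_half alpha).*2)%N ->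
  pf_val alpha p = (pf_val alpha p.-1).+1.
Proof.
move=> le_anti G p2 pt.
have lt : (pf_val alpha p.-1 < pf_val alpha p)%N by apply: pf_val_lt; lia.
case: (ltngtP (pf_val alpha p.-1).+1 (pf_val alpha p)) => [gap|h|-> //]; last lia.
have [j jp ini] := syzygy_tail_initial le_anti p2 pt gap.
have [b nb le_bj] := groebner_divides le_anti G (syzygy_tail_in K p2 pt gap) ini.
by case: nb; apply: divides_term_init jp le_bj.
Qed.

Local Open Scope nat_scope.

(** * Purity *)

Lemma pf_le_dec n (a b : pfaffian_index n) : pf_le a b \/ ~ pf_le a b.
Proof.
case: (boolP ((pf_half b <= pf_half a) &&
  [forall k : 'I_(pf_half b).*2, pf_val a k <= pf_val b k])) => [|/negP] h.
  left; apply/pf_leP; case/andP: h => h1 /forallP h2; split=> // k kb.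
  exact: (h2 (Ordinal kb)).
right=> /pf_leP[h1 h2]; apply: h; rewrite h1; apply/forallP => k; exact: h2.
Qed.

Lemma has_arc_lt n (Z : {set Xplus n}) i j : has_arc Z i j -> i < j < n.
Proof.
by case/existsP => p /and3P[_ /eqP <- /eqP <-]; rewrite (valP p) ltn_ord.
Qed.

(** The left ends in order followed by the right ends in reverse order form an increasing sequence,
    since each left end of a nested chain is smaller than each right end. *)
Lemma chain_index n (Z : {set Xplus n}) (c : seq (nat * nat)) : 0 < size c ->
  sorted nested c -> {in c, forall x, has_arc Z x.1 x.2} ->
  exists b : pfaffian_index n, [/\ pf_half b = size c, arcs_in (has_arc Z) b &
    forall k, k < size c -> pf_val b k = (nth (0, 0) c k).1 /\
      pf_val b ((size c).*2 - k.+1) = (nth (0, 0) c k).2].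
Proof.
move=> s0 srt inZ; set s := size c in s0 *.
pose x k := nth (0, 0) c k.
have Zx k : k < s -> has_arc Z (x k).1 (x k).2.
  by move=> ks; apply/inZ/mem_nth.
have nx k l : k < l -> l < s -> (x k).1 < (x l).1 /\ (x l).2 < (x k).2.
  move=> kl ls; apply/andP.
  by apply: (sorted_ltn_nth nested_trans (0, 0) srt); rewrite ?inE // (ltn_trans kl).
have lr k l : k < s -> l < s -> (x k).1 < (x l).2.
  move=> ks ls; have /andP[hk _] := has_arc_lt (Zx k ks).
  have /andP[hl _] := has_arc_lt (Zx l ls).
  by case: (ltngtP k l) => [kl|lk|<- //];
    [have [] := nx _ _ kl ls|have [] := nx _ _ lk ks]; lia.
pose f k := if k < s then (x k).1 else (x (s.*2 - k.+1)).2.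
have [||b [hb vb]] := @exists_index n s f s0.
- move=> k l kl ls; rewrite /f; case: (ltnP k s) => ks; case: (ltnP l s) => ls'.
  + by have [] := nx _ _ kl ls'.
  + apply: lr => //; lia.
  + lia.
  + by have [] := nx (s.*2 - l.+1) (s.*2 - k.+1) ltac:(lia) ltac:(lia).
- move=> k ks; rewrite /f; case: (ltnP k s) => ks'.
    by have /andP[] := has_arc_lt (Zx k ks'); lia.
  have /has_arc_lt/andP[] := Zx (s.*2 - k.+1) ltac:(lia); lia.
have vbk k : k < s -> pf_val b k = (x k).1 /\ pf_val b (s.*2 - k.+1) = (x k).2.
  move=> ks; rewrite !vb; try lia; rewrite /f ks ltnNge.
  rewrite (_ : s <= s.*2 - k.+1) /=; last lia.
  by rewrite (_ : s.*2 - (s.*2 - k.+1).+1 = k) //; lia.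
exists b; split=> // k; rewrite hb => ks.
by have [-> ->] := vbk k ks; apply: Zx.
Qed.

Lemma card_arc_set n (e : nat -> nat -> bool) : 0 < n ->
  (forall i j, e i j -> i < j < n) ->
  #|[set p : Xplus n | e (val p).1 (val p).2]| =
  \sum_(0 <= i < n.-1) \sum_(0 <= j < n.-1) e i j.+1.
Proof.
case: n => // n _ e_lt /=.
rewrite -(card_imset _ val_inj).
have -> : val @: [set p : Xplus n.+1 | e (val p).1 (val p).2] =
    [set x : 'I_n.+1 * 'I_n.+1 | e x.1 x.2].
  apply/setP => x; rewrite inE; apply/imsetP/idP => [[p]|ex].
    by rewrite inE => ep ->.
  have lt : x.1 < x.2 by have /andP[] := e_lt _ _ ex.
  by exists (Sub x lt : Xplus n.+1); rewrite ?inE.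
rewrite cardsE -sum1_card big_mkcond /=.
rewrite -(pair_big xpredT xpredT (fun i j : 'I_n.+1 => if e i j then 1 else 0)) /=.
rewrite -(big_mkord xpredT (fun i => \sum_(j < n.+1) if e i j then 1 else 0)).
rewrite big_nat_recr //= [X in _ + X]big1 ?addn0; last first.
  by move=> j _; case: ifP => // /e_lt; have := ltn_ord j; lia.
apply: eq_bigr => i _; rewrite big_ord_recl big_mkord.
rewrite (_ : e i (ord0 : 'I_n.+1) = false); last first.
  by apply/negP => /e_lt /andP[]; rewrite ltn0.
by rewrite add0n; apply: eq_bigr => j _; case: (e i j.+1).
Qed.

Section Purity.
Variables (K : fieldType) (n : nat) (alpha : pfaffian_index n).
Variable le : rel 'X_{1..nvars n}.
Hypotheses (G : G_pfaffian K alpha) (le_anti : antidiagonal K le).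
Local Notation t := (pf_half alpha).
Local Notation a := (pf_val alpha).
Local Notation m := (a 1).-1.
Local Notation q := (a t.*2.-1).

Let t_gt0 : 0 < t. Proof. exact: pf_half_gt0. Qed.
Let a01 : a 0 < a 1. Proof. by apply: pf_val_lt; lia. Qed.
Let a0m : a 0 <= m. Proof. lia. Qed.

Let a1q : a 1 <= q.
Proof.
case: (ltngtP 1 t.*2.-1) => [h|h|-> //]; last lia.
by apply/ltnW/pf_val_lt; lia.
Qed.

Let mq : m < q. Proof. lia. Qed.
Let qn : q <= n.-1.
Proof. by have := @pf_val_ltn _ alpha t.*2.-1; lia. Qed.
Let n_gt0 : 0 < n.
Proof. by have := @pf_val_ltn _ alpha 0; lia. Qed.

Let t_gt1 : m.+1 < q -> 1 < t.
Proof.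
case: (ltngtP 1 t) => // t1; first lia.
by rewrite (_ : t.*2.-1 = 1); lia.
Qed.

Let a_mid k : 0 < k -> k.+1 < t.*2 -> a k = m + k.
Proof.
case: k => // k _; elim: k => [|k IHk] kt; first lia.
by rewrite (G_pfaffian_consecutive le_anti G _ kt) // IHk; lia.
Qed.

Lemma Delta_admissible Z : Delta K le alpha Z ->
  admissible (a 0) m q n.-1 t (has_arc Z).
Proof.
move=> DZ.
have le_b b : arcs_in (has_arc Z) b -> pf_le alpha b.
  by move=> /(Delta_pf_le le_anti DZ) h; case: (pf_le_dec alpha b).
have chain c : 0 < size c -> sorted nested c ->
    {in c, forall x, has_arc Z x.1 x.2} -> size c <= t /\
    forall k, k < size c -> a k <= (nth (0, 0) c k).1 /\
      a ((size c).*2 - k.+1) <= (nth (0, 0) c k).2.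
  move=> s0 srt inZ; have [b [hb /le_b/pf_leP[]]] := chain_index s0 srt inZ.
  rewrite hb => h1 h2 vb; split=> // k ks; have [<- <-] := vb k ks.
  split; apply: h2; lia.
split.
- move=> i j Zij; have /andP[ij jn] := has_arc_lt Zij.
  have [//|_ /(_ 0)] := chain [:: (i, j)] isT isT.
    by move=> x; rewrite inE => /eqP ->.
  by move=> /(_ isT) [/= h1 h2]; have {}h2 : a 1 <= j := h2; split=> //; lia.
- move=> i1 j1 i2 j2 Z1 Z2 nst.
  have [||_ /(_ 1 isT) [/= h1 _]] := chain [:: (i1, j1); (i2, j2)] isT.
  + by rewrite /= nst.
  + by move=> x; rewrite !inE => /orP[] /eqP ->.
  by lia.
- move=> c srt inZ; case: (posnP (size c)) => [-> //|s0].
  by have [] := chain c s0 srt inZ.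
- move=> c srt inZ; case: (posnP (size c)) => [-> //|s0].
  have [|h1 h2] := chain c s0 srt; first by move=> x /inZ[].
  (* For a chain of t arcs, position 2t - 1 of b is the right end of the outermost arc, which would
     have to be at least q. *)
  rewrite ltn_neqAle h1 andbT; apply/eqP => st.
  have [_] := h2 0 s0; rewrite st subn1 leqNgt => /negP; apply.
  by have [] := inZ _ (mem_nth (0, 0) s0).
Qed.

Definition extend (Z : {set Xplus n}) : {set Xplus n} :=
  [set p : Xplus n | extension (a 0) m q n.-1 t (has_arc Z) (val p).1 (val p).2].

Lemma extend_sub Z : Delta K le alpha Z -> Z \subset extend Z.
Proof.
move=> /Delta_admissible adm; apply/subsetP => p pZ; rewrite inE.
apply: (extension_sub a0m mq qn t_gt0 t_gt1 adm).
by apply/existsP; exists p; rewrite pZ !eqxx.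
Qed.

(** Positions 1 to 2t - 2 follow from b_1 > m alone, as alpha is consecutive there; the length and
    position 2t - 1 are the two bounds on chains of the extension. *)
Lemma extend_Delta Z : Delta K le alpha Z -> Delta K le alpha (extend Z).
Proof.
move=> DZ; have adm := Delta_admissible DZ.
apply: Delta_intro => // b arcs_b.
set s := pf_half b; pose v := pf_val b.
have s0 : 0 < s by exact: pf_half_gt0.
have ext k : k < s -> extension (a 0) m q n.-1 t (has_arc Z) (v k) (v (s.*2 - k.+1)).
  by move=> /arcs_b /existsP[p /and3P[]]; rewrite inE => h /eqP e1 /eqP e2;
    rewrite /v -e1 -e2.
have u_mono k : k.+1 < s -> v k < v k.+1 by move=> ks; apply: pf_val_lt; lia.
have v_mono k : k.+1 < s -> v (s.*2 - k.+2) < v (s.*2 - k.+1).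
  by move=> ks; apply: pf_val_lt; lia.
have st : s <= t.
  exact: (extension_chain_size a0m mq qn t_gt0 t_gt1 adm s0 u_mono v_mono ext).
apply/pf_leP; split=> // k ks; rewrite -/v.
case/and5P: (ext 0 s0) => e0 _ e1 _ _.
case: k ks => [//|k] ks.
have v1 : m < v 1.
  (* For a single arc b_1 is its right end; otherwise b_1 is the left end of the second arc. *)
  case: (ltnP 1 s) => s1; last by move: e1; rewrite (_ : s.*2 - 1 = 1) //; lia.
  exact: (extension_inner a0m mq qn t_gt0 t_gt1 adm (ext 0 s0) (ext 1 s1)
    (u_mono 0 s1) (v_mono 0 s1)).
have vk : m + k.+1 <= v k.+1.
  by have := @pf_val_ge _ b 1 k ks; rewrite -/v add1n; lia.
case: (ltnP k.+2 t.*2) => kt; first by rewrite a_mid.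
have st' : s = t by lia.
have kE : k.+1 = t.*2.-1 by lia.
rewrite kE leqNgt; apply/negP => lt.
have := extension_short_chain a0m mq qn t_gt0 t_gt1 adm s0 u_mono v_mono ext.
by rewrite subn1 st' ltnn => /(_ lt).
Qed.

(** By maximality a facet equals its extension, whose arcs have been counted. *)
Lemma card_facet Z (adm : admissible (a 0) m q n.-1 t (has_arc Z)) :
  facet (Delta K le alpha) Z ->
  #|Z| = num_jumps m q n.-1 t (has_arc Z) + (m - a 0).
Proof.
case=> DZ maxZ; rewrite -[in LHS](maxZ _ (extend_Delta DZ) (extend_sub DZ)).
rewrite -(extension_count a0m mq qn t_gt0 t_gt1 adm) /extend.
apply: card_arc_set => [|i j /and5P[_ -> _ + _]]; lia.
Qed.

Lemma Delta_pure : pure (Delta K le alpha).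
Proof.
move=> Z1 Z2 f1 f2.
have adm1 := Delta_admissible f1.1; have adm2 := Delta_admissible f2.1.
rewrite (card_facet adm1 f1) (card_facet adm2 f2).
by rewrite (num_jumps_const a0m mq qn t_gt0 t_gt1 adm1 adm2).
Qed.

End Purity.

Theorem corollary3p8 (K : fieldType) (n : nat) (alpha : pfaffian_index n)
    (le : rel 'X_{1..nvars n}) :
  G_pfaffian K alpha -> antidiagonal K le -> pure (Delta K le alpha).
Proof. exact: Delta_pure. Qed.
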